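(* There is an algorithm that solves the scheduling problem $1|r_j;p_j=p|\sum U_j$ in time $O(n^5)$. That is, given $n$ jobs $1,\dots,n$, where each job $j$ has an integer release time $r_j$ and an integer deadline $d_j$, and all jobs have the same positive integer processing time $p$, the algorithm computes in time $O(n^5)$ a non-preemptive single-machine schedule that maximizes the number of completed jobs.
   Context: A (non-preemptive, single-machine) schedule assigns starting times $S_j$ to some subset of the jobs so that each scheduled job $j$ satisfies $r_j \le S_j$ and $S_j + p \le d_j$, and no two scheduled jobs overlap in time (each job occupies the interval $[S_j, S_j+p]$, and these intervals have disjoint interiors). The jobs that are not scheduled are late. The objective, written $\sum U_j$ in Graham's notation, is to minimize the number of late jobs, equivalently to maximize the throughput, i.e. the number of scheduled (completed) jobs. *)

(* Defs.v *)
From HB Require Import structures.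
From mathcomp Require Import all_boot all_order all_algebra.
From mathcomp Require Import reals.

Set Implicit Arguments.
Unset Strict Implicit.
Unset Printing Implicit Defensive.

Import Order.TTheory GRing.Theory Num.Theory.
Local Open Scope ring_scope.

(** * Schedules for n jobs of equal length p *)

(* [S j = Some a]: job j starts at time a; [S j = None]: job j is late.
   Release times and deadlines are integers, but start times may be
   arbitrary real numbers. *)
Definition schedule (R : realType) (n : nat) := 'I_n -> option R.

(* The last clause says that the interiors of the intervals [a, a + p] and
   [b, b + p] occupied by two distinct scheduled jobs are disjoint. *)
Definition feasible (R : realType) (n : nat) (p : int) (r d : n.-tuple int)
    (S : schedule R n) : Prop :=
  (forall (j : 'I_n) (a : R), S j = Some a ->
     (tnth r j)%:~R <= a /\ a + p%:~R <= (tnth d j)%:~R) /\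
  (forall (i j : 'I_n) (a b : R), i != j -> S i = Some a -> S j = Some b ->
     forall x : R, ~ ((x \in `]a, a + p%:~R[) /\ (x \in `]b, b + p%:~R[))).

Definition throughput (R : realType) (n : nat) (S : schedule R n) : nat :=
  #|[set j | isSome (S j)]|.

Definition optimal (R : realType) (n : nat) (p : int) (r d : n.-tuple int)
    (S : schedule R n) : Prop :=
  feasible p r d S /\
  forall S' : schedule R n,
    feasible p r d S' -> (throughput S' <= throughput S)%N.

(** * Unit-cost random access machine *)

(* The instruction set is that of Cook and Reckhow's RAM (constants, addition,
   subtraction, indirect read and write, test for positivity), with structured
   control flow instead of jumps.  Since there is no multiplication, bit
   operation or shift, the bit length of the numbers grows by at most one per
   step, so charging one unit per instruction is the usual convention.
   A program uses finitely many registers, named by natural numbers, and an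
   unbounded memory of integer cells. *)
Record state := State { regs : nat -> int; cells : nat -> int }.

Definition set_reg (s : state) (x : nat) (v : int) : state :=
  State [eta regs s with x |-> v] (cells s).

Definition set_mem (s : state) (a : nat) (v : int) : state :=
  State (regs s) [eta cells s with a |-> v].

Inductive cmd : Type :=
| CSkip
| CConst of nat & int
| CAdd of nat & nat & nat
| CSub of nat & nat & nat
| CRead of nat & nat
| CWrite of nat & nat
| CSeq of cmd & cmd
| CIf of nat & cmd & cmd
| CWhile of nat & cmd.

(* [exec c s t s']: started in s, the program c halts in s' after t steps.
   Every instruction and every evaluation of a test is one step.  Accessing a
   negative address blocks the machine: no rule applies. *)
Inductive exec : cmd -> state -> nat -> state -> Prop :=
| ExecSkip s : exec CSkip s 1 s
| ExecConst s x v : exec (CConst x v) s 1 (set_reg s x v)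
| ExecAdd s x y z : exec (CAdd x y z) s 1 (set_reg s x (regs s y + regs s z))
| ExecSub s x y z : exec (CSub x y z) s 1 (set_reg s x (regs s y - regs s z))
| ExecRead s x y (a : nat) : regs s y = a%:Z ->
    exec (CRead x y) s 1 (set_reg s x (cells s a))
| ExecWrite s x y (a : nat) : regs s x = a%:Z ->
    exec (CWrite x y) s 1 (set_mem s a (regs s y))
| ExecSeq c1 c2 s s1 s2 t1 t2 : exec c1 s t1 s1 -> exec c2 s1 t2 s2 ->
    exec (CSeq c1 c2) s (t1 + t2) s2
| ExecIfTrue x c1 c2 s t s' : 0 < regs s x -> exec c1 s t s' ->
    exec (CIf x c1 c2) s t.+1 s'
| ExecIfFalse x c1 c2 s t s' : regs s x <= 0 -> exec c2 s t s' ->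
    exec (CIf x c1 c2) s t.+1 s'
| ExecWhileTrue x c s s1 s2 t1 t2 : 0 < regs s x -> exec c s t1 s1 ->
    exec (CWhile x c) s1 t2 s2 -> exec (CWhile x c) s (t1 + t2).+1 s2
| ExecWhileFalse x c s : regs s x <= 0 -> exec (CWhile x c) s 1 s.

(* The machine is deterministic, so [exec c s t s'] determines the running
   time and the result of c on s. *)
Lemma exec_det c s t1 s1 t2 s2 :
  exec c s t1 s1 -> exec c s t2 s2 -> t1 = t2 /\ s1 = s2.
Proof.
move=> E; elim: E t2 s2 => {c s t1 s1}; intros;
  match goal with H : exec _ _ ?t ?s |- _ = ?t /\ _ = ?s => inversion H; subst end;
  repeat match goal with
  | IH : forall t s, exec ?c ?s0 t s -> _, H : exec ?c ?s0 _ _ |- _ =>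
      case: (IH _ _ H) => ? ?; subst; clear IH
  | H1 : is_true (0 < ?x), H2 : is_true (?x <= 0) |- _ =>
      by move: H1; rewrite ltNge H2
  | H1 : ?x = Posz ?a, H2 : ?x = Posz ?b |- _ =>
      move: H2; rewrite H1 => -[?]; subst
  end; by [].
Qed.

(* Register 0 holds n, register 1 holds p; cells 0, ..., n-1 hold the release
   times and cells n, ..., 2n-1 the deadlines; everything else is 0. *)
Definition input (n : nat) (p : int) (r d : n.-tuple int) : state :=
  State (nth 0 [:: n%:Z; p]) (nth 0 (r ++ d)).

(* On halting, cell j is 0 if job j is late; otherwise job j is scheduled and
   cell n + j holds its start time. *)
Definition output (R : realType) (n : nat) (s : state) : schedule R n :=
  fun j => if cells s j == 0 then None else Some (cells s (n + j)%N)%:~R.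

(* Main.v *)
Require Import Defs.
From mathcomp Require Import all_boot all_order all_algebra zify.
From mathcomp Require Import reals.
Import Order.TTheory GRing.Theory Num.Theory.
Local Open Scope ring_scope.

(** Let A consist of the k jobs of smallest deadlines, let b be the next job,
    and let f(A, y, u) be the least completion time of a schedule of u jobs of A
    that are released after y - p and start at or after y.  By an exchange
    argument, a schedule using b may be assumed to run only jobs released after
    the start s of b after it; the part before b is then a schedule for (A, y)
    and the part after b one for (A, s + p), and taking the first part as
    short as possible is best for both b and the second part.  Hence
    f(A + b, y, u) is the minimum of f(A, y, u) and of
    f(A, s + p, u - 1 - l) over l < u, where s is the maximum of r_b and
    f(A, y, l).  All values that occur are of the form r_i + m p with m <= n, so
    that there are O(n^4) states with O(n) candidates each.  A state also
    stores a whole schedule, at O(n) cost, from which the output is copied.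
    Rounding start times down shows that real start times give nothing more
    than integer ones. *)

(** * A language with expressions, arrays and loops over O(n) values *)

(** The running time is read off the syntax. The only loops of the language run over n or n + 1
    values, so every program terminates, its meaning [den] is a total function, and its time is at
    most a constant times (n + 1)^depth. The scheduler has depth 5: the layers, the three indices of
    a state, and an innermost loop over either the candidates or the jobs of a schedule to be
    copied. As the machine cannot multiply, a value r_i + m p is represented by a code, the number
    with digits i, m, 0 in base n + 1. A code serves both to look up the value and to address the
    states that start there; the latter is needed because the completion time of the left part
    decides where the right part starts. A code has room for m <= n only. The least completion time
    of u jobs from r_i + m p has a multiple m' <= m + u of p, and joining l jobs, b and u - 1 - l
    jobs stays within m + u. Hence only states with m + u <= n are relied on; the others are
    computed too, with no claim about them. *)

Record store := Store { var : nat -> int; arr : nat -> nat -> int }.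

Definition setv (a : store) (x : nat) (v : int) : store :=
  Store (fun y => if y == x then v else var a y) (arr a).

Definition seta (a : store) (k i : nat) (v : int) : store :=
  Store (var a) (fun k' i' => if (k' == k) && (i' == i) then v else arr a k' i').

Definition incv (a : store) (x : nat) : store := setv a x (var a x + 1).

Inductive exp : Type :=
| Cst of int
| Var of nat
| Plus of exp & exp
| Minus of exp & exp
| Get of nat & exp.

Inductive stmt : Type :=
| Asg of nat & exp
| Put of nat & exp & exp
| Seq of stmt & stmt
| If of exp & stmt & stmt
| For of nat & bool & stmt.

(* Array 0 is the input/output area, of length 2n.  It is clipped so that no
   index reaches the memory of the other arrays. *)
Definition slot (n k : nat) (v : int) : nat :=
  if k == 0%N then minn `|v|%N (n + n) else `|v|%N.

Fixpoint eval (n : nat) (e : exp) (a : store) : int :=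
  match e with
  | Cst c => c
  | Var x => var a x
  | Plus e1 e2 => eval n e1 a + eval n e2 a
  | Minus e1 e2 => eval n e1 a - eval n e2 a
  | Get k e => arr a k (slot n k (eval n e a))
  end.

(* [For x b c] runs c for x = 0, ..., n - 1 + b. *)
Fixpoint den (n : nat) (c : stmt) (a : store) : store :=
  match c with
  | Asg x e => setv a x (eval n e a)
  | Put k e1 e2 => seta a k (slot n k (eval n e1 a)) (eval n e2 a)
  | Seq c1 c2 => den n c2 (den n c1 a)
  | If e c1 c2 => if 0 < eval n e a then den n c1 a else den n c2 a
  | For x b c =>
      iter (n + b)%N (fun a => incv (den n c a) x)
        (setv a x 0)
  end.

(* Arrays 1, ..., 7 are interleaved behind the first 2n cells. *)
Definition addr (n k i : nat) : nat :=
  if k == 0%N then i else (i * 8 + n + n + k)%N.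

(** The absolute value of the index is taken because a negative address would block the machine.
    Multiplication by 8 is done by three doublings. For array 0 the index is cut to 2n, a spare cell
    that absorbs every access out of range. *)
Definition locate (k t : nat) : cmd :=
  CSeq (CConst t.+1 0)
 (CSeq (CIf t CSkip (CSub t t.+1 t))
 (if k == 0%N then
    CSeq (CAdd t.+1 0 0)
   (CSeq (CSub t.+2 t.+1 t)
   (CIf t.+2 CSkip (CSeq (CConst t.+2 0) (CAdd t t.+1 t.+2))))
  else
    CSeq (CAdd t t t) (CSeq (CAdd t t t) (CSeq (CAdd t t t)
   (CSeq (CAdd t t 0) (CSeq (CAdd t t 0)
   (CSeq (CConst t.+1 k%:Z) (CAdd t t t.+1)))))))).

Fixpoint compile_exp (e : exp) (t : nat) : cmd :=
  match e with
  | Cst c => CConst t c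
  | Var x => CSeq (CConst t 0) (CAdd t t x)
  | Plus e1 e2 =>
      CSeq (compile_exp e1 t) (CSeq (compile_exp e2 t.+1) (CAdd t t t.+1))
  | Minus e1 e2 =>
      CSeq (compile_exp e1 t) (CSeq (compile_exp e2 t.+1) (CSub t t t.+1))
  | Get k e => CSeq (compile_exp e t) (CSeq (locate k t) (CRead t t))
  end.

Fixpoint compile (c : stmt) (t : nat) : cmd :=
  match c with
  | Asg x e =>
      CSeq (compile_exp e t) (CSeq (CConst t.+1 0) (CAdd x t t.+1))
  | Put k e1 e2 =>
      CSeq (compile_exp e1 t)
     (CSeq (locate k t) (CSeq (compile_exp e2 t.+1) (CWrite t t.+1)))
  | Seq c1 c2 => CSeq (compile c1 t) (compile c2 t)
  | If e c1 c2 => CSeq (compile_exp e t) (CIf t (compile c1 t) (compile c2 t))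
  | For x b c =>
      CSeq (CConst t b%:Z) (CSeq (CAdd t t 0) (CSeq (CConst x 0)
     (CWhile t
       (CSeq (compile c t.+1)
       (CSeq (CConst t.+1 1)
       (CSeq (CAdd x x t.+1) (CSub t t t.+1)))))))
  end.

(* Programs use the registers below 32, the compiler those from 32 on. *)
Fixpoint wf_exp (e : exp) : bool :=
  match e with
  | Cst _ => true
  | Var x => (x < 32)%N
  | Plus e1 e2 => wf_exp e1 && wf_exp e2
  | Minus e1 e2 => wf_exp e1 && wf_exp e2
  | Get k e => (k < 8)%N && wf_exp e
  end.

Fixpoint wf (c : stmt) : bool :=
  match c with
  | Asg x e => (0 < x < 32)%N && wf_exp e
  | Put k e1 e2 => [&& (k < 8)%N, wf_exp e1 & wf_exp e2]
  | Seq c1 c2 => wf c1 && wf c2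
  | If e c1 c2 => [&& wf_exp e, wf c1 & wf c2]
  | For x b c => (0 < x < 32)%N && wf c
  end.

Fixpoint cost_exp (e : exp) : nat :=
  match e with
  | Cst _ => 1
  | Var _ => 2
  | Plus e1 e2 => (cost_exp e1 + cost_exp e2 + 1)%N
  | Minus e1 e2 => (cost_exp e1 + cost_exp e2 + 1)%N
  | Get _ e => (cost_exp e + 20)%N
  end.

Fixpoint depth (c : stmt) : nat :=
  match c with
  | Asg _ _ | Put _ _ _ => 0
  | Seq c1 c2 | If _ c1 c2 => maxn (depth c1) (depth c2)
  | For _ _ c => (depth c).+1
  end.

(** The factor in front of (n + 1)^depth. In a loop, 8 pays for 4 steps per round (test, increment,
    countdown) and for 4 steps of set-up and final test. An array access costs 19 steps for the
    address and one for the access. *)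
Fixpoint cost (c : stmt) : nat :=
  match c with
  | Asg _ e => (cost_exp e + 2)%N
  | Put _ e1 e2 => (cost_exp e1 + cost_exp e2 + 20)%N
  | Seq c1 c2 => (cost c1 + cost c2)%N
  | If e c1 c2 => (cost_exp e + 1 + (cost c1 + cost c2))%N
  | For _ _ c => (cost c + 8)%N
  end.

(** * Simulation of the language by the machine, with its running time *)

Definition sim (n : nat) (s : state) (a : store) : Prop :=
  [/\ regs s 0%N = n%:Z,
      forall x, (x < 32)%N -> regs s x = var a x
    & forall k i, (k < 8)%N -> (k = 0%N -> (i <= n + n)%N) ->
        cells s (addr n k i) = arr a k i].

Lemma slot_le n k v : k = 0%N -> (slot n k v <= n + n)%N.
Proof. by move=> ->; rewrite /slot /= geq_minr. Qed.

Lemma addr_inj n k i k' i' : (k < 8)%N -> (k' < 8)%N ->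
  (k = 0%N -> (i <= n + n)%N) -> (k' = 0%N -> (i' <= n + n)%N) ->
  (addr n k i == addr n k' i') = (k == k') && (i == i').
Proof. by rewrite /addr => *; do 2 case: ifP => /eqP ?; lia. Qed.

Lemma sim_frame n s s' t a : (32 <= t)%N -> sim n s a -> cells s' = cells s ->
  (forall x, (x < t)%N -> regs s' x = regs s x) -> sim n s' a.
Proof.
move=> t32 [H0 HR HC] C F; split; first by rewrite F ?H0 //; lia.
  by move=> x x32; rewrite F ?HR //; lia.
by move=> k i *; rewrite C HC.
Qed.

Lemma exec_locate n k t s : (32 <= t)%N -> (k < 8)%N -> regs s 0%N = n%:Z ->
  exists m s',
    [/\ exec (locate k t) s m s', (m <= 19)%N, cells s' = cells s,
        regs s' t = (addr n k (slot n k (regs s t)))%:Z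
      & forall x, (x < t)%N -> regs s' x = regs s x].
Proof.
move=> t32 k8 s0; rewrite /locate.
have E1 : (t == t.+1) = false by lia.
have E2 : (t == t.+2) = false by lia.
have E3 : (t.+1 == t) = false by lia.
have E4 : (t.+1 == t.+2) = false by lia.
have E0 : (0%N == t) = false by lia.
have E01 : (0%N == t.+1) = false by lia.
have E02 : (0%N == t.+2) = false by lia.
have E20 : (t.+2 == t) = false by lia.
have E21 : (t.+2 == t.+1) = false by lia.
have EE := (E1, E2, E3, E4, E0, E01, E02, E20, E21, eqxx).
have lt_ne x y : (x < t)%N -> (t <= y)%N -> (x == y) = false by lia.
pose s1 := set_reg s t.+1 0.
have [m1 [s2 [X1 M1 C1 R1 F1]]] : exists m s',
    [/\ exec (CIf t CSkip (CSub t t.+1 t)) s1 m s', (m <= 2)%N,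
        cells s' = cells s, regs s' t = `|regs s t|%N%:Z
      & forall x, (x < t)%N -> regs s' x = regs s x].
  have [v_gt0|v_le0] := ltP 0 (regs s t); do 2 eexists; split.
  - by apply: ExecIfTrue; [rewrite /= !EE | exact: ExecSkip].
  - by [].
  - by [].
  - by rewrite /= !EE; lia.
  - by move=> x xt; rewrite /= !lt_ne.
  - by apply: ExecIfFalse; [rewrite /= !EE | exact: ExecSub].
  - by [].
  - by [].
  - by rewrite /= !EE; lia.
  - by move=> x xt; rewrite /= !lt_ne //; lia.
have s20 : regs s2 0%N = n%:Z by rewrite F1 //; lia.
move: k8; rewrite /slot /addr; case: eqP => [-> _|kN0 k8]; last first.
  do 2 eexists; split.
  - apply: ExecSeq (ExecConst _ _ _) _; apply: ExecSeq X1 _.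
    by do 6 (apply: ExecSeq; first by [exact: ExecAdd | exact: ExecConst]); exact: ExecAdd.
  - by lia.
  - by [].
  - by rewrite /= !EE s20 R1; lia.
  - by move=> x xt; rewrite /= !lt_ne ?F1 //; lia.
have [v_lt|v_ge] := ltP `|regs s t|%N (n + n)%N; do 2 eexists; split.
- apply: ExecSeq (ExecConst _ _ _) _; apply: ExecSeq X1 _.
  do 2 (apply: ExecSeq; first by [exact: ExecAdd | exact: ExecSub]).
  by apply: ExecIfTrue; [rewrite /= !EE s20 R1; lia | exact: ExecSkip].
- by lia.
- by [].
- by rewrite /= !EE R1; lia.
- by move=> x xt; rewrite /= !lt_ne ?F1 //; lia.
- apply: ExecSeq (ExecConst _ _ _) _; apply: ExecSeq X1 _.
  do 2 (apply: ExecSeq; first by [exact: ExecAdd | exact: ExecSub]).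
  apply: ExecIfFalse; first by rewrite /= !EE s20 R1; lia.
  by apply: ExecSeq; [exact: ExecConst | exact: ExecAdd].
- by lia.
- by [].
- by rewrite /= !EE s20; lia.
- by move=> x xt; rewrite /= !lt_ne ?F1 //; lia.
Qed.

Lemma exec_compile_exp n e s a t :
  sim n s a -> (32 <= t)%N -> wf_exp e ->
  exists m s',
    [/\ exec (compile_exp e t) s m s', (m <= cost_exp e)%N, cells s' = cells s,
        regs s' t = eval n e a
      & forall x, (x < t)%N -> regs s' x = regs s x].
Proof.
have lt_ne x y : (x < y)%N -> (x == y) = false by lia.
elim: e s t => [c|x|e1 IH1 e2 IH2|e1 IH1 e2 IH2|k e IH] s t S t32 /=.
- move=> _; do 2 eexists; split; first exact: ExecConst.
  + by [].
  + by [].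
  + by rewrite /= eqxx.
  + by move=> x xt; rewrite /= lt_ne.
- move=> x32; do 2 eexists; split.
  + by apply: ExecSeq; [exact: ExecConst | exact: ExecAdd].
  + by [].
  + by [].
  + case: S => _ HR _; rewrite /= !eqxx lt_ne; last by lia.
    by rewrite HR // add0r.
  + by move=> y yt; rewrite /= !lt_ne.
- case/andP=> W1 W2.
  have [m1 [s1 [X1 M1 C1 R1 F1]]] := IH1 s t S t32 W1.
  have S1 := sim_frame _ _ _ _ _ t32 S C1 F1.
  have [m2 [s2 [X2 M2 C2 R2 F2]]] := IH2 s1 t.+1 S1 (leqW t32) W2.
  do 2 eexists; split.
  + by apply: ExecSeq X1 _; apply: ExecSeq X2 _; exact: ExecAdd.
  + by lia.
  + by rewrite /= C2.
  + by rewrite /= eqxx R2 F2 // R1.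
  + by move=> x xt; rewrite /= lt_ne // F2 ?F1 //; lia.
- case/andP=> W1 W2.
  have [m1 [s1 [X1 M1 C1 R1 F1]]] := IH1 s t S t32 W1.
  have S1 := sim_frame _ _ _ _ _ t32 S C1 F1.
  have [m2 [s2 [X2 M2 C2 R2 F2]]] := IH2 s1 t.+1 S1 (leqW t32) W2.
  do 2 eexists; split.
  + by apply: ExecSeq X1 _; apply: ExecSeq X2 _; exact: ExecSub.
  + by lia.
  + by rewrite /= C2.
  + by rewrite /= eqxx R2 F2 // R1.
  + by move=> x xt; rewrite /= lt_ne // F2 ?F1 //; lia.
- case/andP=> k8 W.
  have [m1 [s1 [X1 M1 C1 R1 F1]]] := IH s t S t32 W.
  have [S10 _ HC] := sim_frame _ _ _ _ _ t32 S C1 F1.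
  have [m2 [s2 [X2 M2 C2 R2 F2]]] := exec_locate n k t s1 t32 k8 S10.
  do 2 eexists; split.
  + by apply: ExecSeq X1 _; apply: ExecSeq X2 _; exact: ExecRead R2.
  + by lia.
  + by rewrite /= C2.
  + rewrite /= eqxx C2 R1 HC //.
    by move/slot_le; exact.
  + by move=> x xt; rewrite /= lt_ne // F2 ?F1 //; lia.
Qed.

(** The scratch registers form a stack: code compiled at [t] leaves those from 32 to [t - 1] alone,
    so the countdown of a loop, kept in [t], survives the body compiled at [t + 1]. Register 0 keeps
    n for the address computations, since [wf] admits no assignment to it. *)
Lemma exec_compile n c s a t :
  sim n s a -> (32 <= t)%N -> wf c ->
  exists m s',
    [/\ exec (compile c t) s m s', (m <= cost c * n.+1 ^ depth c)%N,
        sim n s' (den n c a)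
      & forall x, (32 <= x < t)%N -> regs s' x = regs s x].
Proof.
have ltn_ne x y : (x < y)%N -> (x == y) = false by lia.
have gtn_ne x y : (y < x)%N -> (x == y) = false by lia.
elim: c s a t => [x e|k e1 e2|c1 IH1 c2 IH2|e c1 IH1 c2 IH2|x b c IH] s a t S t32 /=.
- case/andP=> /andP[x0 x32] W.
  have [m1 [s1 [X1 M1 C1 R1 F1]]] := exec_compile_exp n e s a t S t32 W.
  have [S10 HR HC] := sim_frame _ _ _ _ _ t32 S C1 F1.
  do 2 eexists; split.
  + apply: ExecSeq X1 _; apply: ExecSeq; [exact: ExecConst | exact: ExecAdd].
  + by rewrite expn0; lia.
  + split.
    * by rewrite /= !ltn_ne //; lia.
    * move=> y y32 /=; case: eqP => [_|_]; last by rewrite ltn_ne ?HR //; lia.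
      by rewrite ltn_ne // eqxx R1 addr0.
    * by move=> k i *; rewrite /= HC.
  + move=> y /andP[y32 yt] /=; rewrite gtn_ne; last by lia.
    by rewrite ltn_ne ?F1 //; lia.
- case/and3P=> k8 W1 W2.
  have [m1 [s1 [X1 M1 C1 R1 F1]]] := exec_compile_exp n e1 s a t S t32 W1.
  have [S10 _ _] := sim_frame _ _ _ _ _ t32 S C1 F1.
  have [m2 [s2 [X2 M2 C2 R2 F2]]] := exec_locate n k t s1 t32 k8 S10.
  have F2' x : (x < t)%N -> regs s2 x = regs s x by move=> xt; rewrite F2 ?F1.
  have S2 := sim_frame _ _ _ _ _ t32 S (etrans C2 C1) F2'.
  have [m3 [s3 [X3 M3 C3 R3 F3]]] := exec_compile_exp n e2 s2 a t.+1 S2 (leqW t32) W2.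
  have F3' x : (x < t)%N -> regs s3 x = regs s x.
    by move=> xt; rewrite F3 ?F2' //; lia.
  have [S30 HR HC] := sim_frame _ _ _ _ _ t32 S (etrans C3 (etrans C2 C1)) F3'.
  do 2 eexists; split.
  + apply: ExecSeq X1 _; apply: ExecSeq X2 _; apply: ExecSeq X3 _.
    by apply: ExecWrite; rewrite F3 // R2.
  + by rewrite expn0; lia.
  + split=> //= k' i' k'8 H.
    rewrite addr_inj //; last exact: slot_le.
    by rewrite R1; case: ifP => // _; rewrite HC.
  + by move=> y /andP[y32 yt] /=; rewrite F3'.
- case/andP=> W1 W2.
  have [m1 [s1 [X1 M1 S1 F1]]] := IH1 s a t S t32 W1.
  have [m2 [s2 [X2 M2 S2 F2]]] := IH2 s1 _ t S1 t32 W2.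
  do 2 eexists; split; [exact: ExecSeq X1 X2 | | by [] |].
  + rewrite mulnDl leq_add //; [apply: leq_trans M1 _|apply: leq_trans M2 _];
    by rewrite leq_mul // leq_pexp2l // ?leq_maxl ?leq_maxr.
  + by move=> y Hy; rewrite F2 ?F1.
- case/and3P=> W W1 W2.
  have [m [s0 [X M C R F]]] := exec_compile_exp n e s a t S t32 W.
  have S0 := sim_frame _ _ _ _ _ t32 S C F.
  have pos d : (0 < n.+1 ^ d)%N by rewrite expn_gt0.
  have [m1 [s1 [X1 M1 S1 F1]]] := IH1 s0 a t S0 t32 W1.
  have [m2 [s2 [X2 M2 S2 F2]]] := IH2 s0 a t S0 t32 W2.
  have le1 : (m1 <= cost c1 * n.+1 ^ maxn (depth c1) (depth c2))%N.
    by apply: leq_trans M1 _; rewrite leq_mul // leq_pexp2l // leq_maxl.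
  have le2 : (m2 <= cost c2 * n.+1 ^ maxn (depth c1) (depth c2))%N.
    by apply: leq_trans M2 _; rewrite leq_mul // leq_pexp2l // leq_maxr.
  have P := pos (maxn (depth c1) (depth c2)).
  have le0 : (m + 1 <= (cost_exp e + 1) * n.+1 ^ maxn (depth c1) (depth c2))%N.
    by rewrite -[(m + 1)%N]muln1 leq_mul // leq_add2r.
  rewrite !mulnDl; rewrite mulnDl in le0.
  have [pe|npe] := ltP 0 (eval n e a); do 2 eexists; split.
  + by apply: ExecSeq X _; apply: ExecIfTrue X1; rewrite R.
  + by lia.
  + by [].
  + by move=> y /[dup] Hy /andP[_ yt]; rewrite F1 ?F.
  + by apply: ExecSeq X _; apply: ExecIfFalse X2; rewrite R.
  + by lia.
  + by [].
  + by move=> y /[dup] Hy /andP[_ yt]; rewrite F2 ?F.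
case/andP=> /andP[x0 x32] W.
set body := CSeq (compile c t.+1) _.
set K := (cost c * n.+1 ^ depth c)%N.
(* [j] is the countdown, so the number of rounds is fixed even though the variable [x] is visible to
   the body. *)
have loop j s1 a1 : sim n s1 a1 -> regs s1 t = j%:Z -> exists m s',
    [/\ exec (CWhile t body) s1 m s', (m <= j * (K + 4) + 1)%N,
        sim n s' (iter j (fun a => incv (den n c a) x) a1)
      & forall y, (32 <= y < t)%N -> regs s' y = regs s1 y].
  elim: j s1 a1 => [|j IHj] s1 a1 S1 R1.
    exists 1%N, s1; split=> //.
    by apply: ExecWhileFalse; rewrite R1.
  have [m2 [s2 [X2 M2 S2 F2]]] := IH s1 a1 t.+1 S1 (leqW t32) W.
  pose s3 := set_reg (set_reg (set_reg s2 t.+1 1) x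
    (regs s2 x + 1)) t (regs s2 t - 1).
  have X3 : exec body s1 (m2 + 3) s3.
    apply: ExecSeq X2 _; rewrite (_ : 3 = 1 + (1 + 1))%N //.
    apply: ExecSeq; first exact: ExecConst.
    have E1 : (x == t.+1) = false by lia.
    have E2 : (t.+1 == x) = false by lia.
    have E3 : (t == t.+1) = false by lia.
    have E4 : (t == x) = false by lia.
    apply: ExecSeq; first exact: ExecAdd.
    rewrite /= E1 eqxx.
    have := ExecSub (set_reg (set_reg s2 t.+1 1) x (regs s2 x + 1)) t t t.+1.
    by rewrite /= E2 E3 E4 eqxx.
  have Rt : regs s3 t = j%:Z.
    by rewrite /= eqxx F2 ?R1; lia.
  have S3 : sim n s3 (incv (den n c a1) x).
    case: S2 => H0 HR HC; split.
    - by rewrite /= !ltn_ne ?H0 //; lia.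
    - move=> y y32 /=; rewrite ltn_ne; last by lia.
      by case: eqP => _; rewrite ?HR // ltn_ne ?HR //; lia.
    - by move=> k i *; rewrite /= HC.
  have [m4 [s4 [X4 M4 S4 F4]]] := IHj s3 _ S3 Rt.
  do 2 eexists; split; first by apply: ExecWhileTrue X3 X4; rewrite R1.
  - by rewrite mulSn; rewrite -/K in M2; lia.
  - by rewrite iterSr.
  - by move=> y Hy; rewrite F4 //= (ltn_ne y t) ?(gtn_ne y x) ?(ltn_ne y t.+1) ?F2; lia.
pose s1 := set_reg (set_reg (set_reg s t b%:Z) t (b%:Z + n%:Z)) x 0.
have E0 : (0%N == t) = false by lia.
have R1 : regs s1 t = (n + b)%N%:Z.
  by rewrite /= gtn_ne ?eqxx //; lia.
have S1 : sim n s1 (setv a x 0).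
  case: S => H0 HR HC; split.
  - by rewrite /= !ltn_ne //; lia.
  - by move=> y y32 /=; case: eqP => // _; rewrite !ltn_ne ?HR //; lia.
  - by move=> k i *; rewrite /= HC.
have [m2 [s2 [X2 M2 S2 F2]]] := loop _ _ _ S1 R1.
do 2 eexists; split.
- apply: ExecSeq; first exact: ExecConst.
  apply: ExecSeq; first exact: ExecAdd.
  apply: ExecSeq; first exact: ExecConst.
  rewrite /= eqxx E0; case: S => -> _ _; exact: X2.
- have P : (0 < n.+1 ^ depth c)%N by rewrite expn_gt0.
  apply: (@leq_trans (3 + (n.+1 * (K + 4) + 1))).
    have : ((n + b) * (K + 4) <= n.+1 * (K + 4))%N.
      by rewrite leq_mul2r; case: (b); lia.
    by move: M2; lia.
  rewrite expnS /K; set P0 := (n.+1 ^ _)%N in P *.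
  have : (n.+1 <= n.+1 * P0)%N by rewrite leq_pmulr.
  lia.
- exact: S2.
- by move=> y Hy; rewrite F2 //= (gtn_ne y x) ?(ltn_ne y t) ?F2; lia.
Qed.

(** * Frames and weakest preconditions *)

Fixpoint mods (c : stmt) : seq nat :=
  match c with
  | Asg x _ => [:: x]
  | Put _ _ _ => [::]
  | Seq c1 c2 | If _ c1 c2 => mods c1 ++ mods c2
  | For x _ c => x :: mods c
  end.

Fixpoint amods (c : stmt) : seq nat :=
  match c with
  | Asg _ _ => [::]
  | Put k _ _ => [:: k]
  | Seq c1 c2 | If _ c1 c2 => amods c1 ++ amods c2
  | For _ _ c => amods c
  end.

Definition unchanged (c : stmt) (a a' : store) : Prop :=
  (forall x, x \notin mods c -> var a' x = var a x) /\
  (forall k, k \notin amods c -> forall i, arr a' k i = arr a k i).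

Lemma unchanged_trans c a1 a2 a3 :
  unchanged c a1 a2 -> unchanged c a2 a3 -> unchanged c a1 a3.
Proof.
move=> [H1 H2] [H3 H4]; split=> [x xc|k kc i].
  by rewrite H3 ?H1.
by rewrite H4 ?H2.
Qed.

Lemma unchanged_for x b c a a' : unchanged c a a' -> unchanged (For x b c) a a'.
Proof.
move=> [HV HA]; split=> //= y; rewrite inE negb_or => /andP[_].
exact: HV.
Qed.

Lemma den_unchanged n c a : unchanged c a (den n c a).
Proof.
elim: c a => [x e|k e1 e2|c1 IH1 c2 IH2|e c1 IH1 c2 IH2|x b c IH] a /=.
- by split=> //= y; rewrite inE => /negPf->.
- by split=> //= k'; rewrite inE => /negPf->.
- have [H1 H2] := IH1 a; have [H3 H4] := IH2 (den n c1 a).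
  split=> /= [x|k]; rewrite mem_cat negb_or => /andP[h1 h2].
    by rewrite H3 ?H1.
  by move=> i; rewrite H4 ?H2.
- have [H1 H2] := IH1 a; have [H3 H4] := IH2 a.
  split=> /= [x|k]; rewrite mem_cat negb_or => /andP[h1 h2]; case: ifP => _;
    by auto.
elim: (n + b)%N => [|j [H1 H2]] /=.
  by split=> //= y; rewrite inE negb_or => /andP[/negPf-> _].
set a1 := iter _ _ _ in H1 H2 *; have [H3 H4] := IH a1.
split=> /= [y|k kc i]; last by rewrite H4 ?H2.
by rewrite inE negb_or => /andP[/[dup] yx /negPf-> yc]; rewrite H3 // H1 // inE negb_or yx.
Qed.

Definition wp (n : nat) (c : stmt) (Q : store -> Prop) (a : store) : Prop :=
  Q (den n c a).

(** Combines the rule of consequence with the frame rule: the frame is computed from the syntax, so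
    a specification mentions only what a program changes. *)
Lemma wp_weaken n c (Q Q' : store -> Prop) a : wp n c Q a ->
  (forall a', unchanged c a a' -> Q a' -> Q' a') -> wp n c Q' a.
Proof. by move=> H; apply=> //; exact: den_unchanged. Qed.

Lemma wp_asg n x e (Q : store -> Prop) a :
  (forall v, v = eval n e a -> Q (setv a x v)) -> wp n (Asg x e) Q a.
Proof. exact. Qed.

Lemma wp_put n k e1 e2 (Q : store -> Prop) a :
  (forall i v, i = slot n k (eval n e1 a) -> v = eval n e2 a ->
     Q (seta a k i v)) ->
  wp n (Put k e1 e2) Q a.
Proof. exact. Qed.

Lemma wp_seq n c1 c2 Q a : wp n c1 (wp n c2 Q) a -> wp n (Seq c1 c2) Q a.
Proof. by []. Qed.

Lemma wp_if n e c1 c2 (Q : store -> Prop) a :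
  (0 < eval n e a -> wp n c1 Q a) -> (eval n e a <= 0 -> wp n c2 Q a) ->
  wp n (If e c1 c2) Q a.
Proof.
rewrite /wp /= => H1 H2; case: ifP => [/H1 //|/negbT].
by rewrite -leNgt => /H2.
Qed.

(** The frame relative to the store before the loop and the value of the counter are supplied to
    every round, so an invariant need not carry them. *)
Lemma wp_for n x (b : bool) c (I : nat -> store -> Prop) Q a :
  x \notin mods c -> I 0%N (setv a x 0) ->
  (forall i a', (i < n + b)%N -> unchanged (For x b c) a a' -> var a' x = i%:Z ->
     I i a' -> wp n c (fun a'' => I i.+1 (setv a'' x i.+1)) a') ->
  (forall a', unchanged (For x b c) a a' -> I (n + b)%N a' -> Q a') ->
  wp n (For x b c) Q a.
Proof.
move=> xc I0 IS; rewrite /wp; apply; first exact: den_unchanged.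
move=> /=; set f := fun a' => _.
suff H j : (j <= n + b)%N -> [/\ unchanged (For x b c) a (iter j f (setv a x 0)),
    var (iter j f (setv a x 0)) x = j%:Z & I j (iter j f (setv a x 0))].
  by have [] := H _ (leqnn _).
elim: j => [_|j IH jn].
  split=> //; last by rewrite /= eqxx.
  by split=> //= y; rewrite inE negb_or => /andP[/negPf-> _].
have [U E Ij] := IH (ltnW jn); rewrite iterS; set a1 := iter j f _ in U E Ij *.
have [H1 H2] := den_unchanged n c a1.
have fE : f a1 = setv (den n c a1) x j.+1%:Z.
  by rewrite /f /incv H1 // E; congr setv; lia.
split.
- apply: unchanged_trans U _; rewrite fE; split=> //= y.
  by rewrite inE negb_or => /andP[/negPf-> /H1].
- by rewrite fE /= eqxx.
- by rewrite fE; exact: IS.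
Qed.

(** * Scheduling with integer start times *)

Section Combinatorics.
Variables (n : nat) (p : int) (r d : n.-tuple int).
Hypothesis p_gt0 : 0 < p.
Implicit Types (A J : {set 'I_n}) (y c t : int) (S : 'I_n -> int).

(** [c] is any bound on the completion times, not the exact one, and [y <= c] gives the empty
    schedule the least completion time [y]. *)
Definition sched A y c J S : Prop :=
  [/\ J \subset A, y <= c,
      forall j, j \in J -> [/\ y - p < tnth r j, tnth r j <= S j, y <= S j,
        S j + p <= c & S j + p <= tnth d j]
    & forall i j, i \in J -> j \in J -> i != j ->
        S i + p <= S j \/ S j + p <= S i].

Definition packed A y c (u : nat) : Prop :=
  exists J S, sched A y c J S /\ #|J| = u.

(** The form in which a schedule is stored. Flags and starts vanish outside [J], so that disjoint
    schedules are merged by adding their arrays. *)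
Definition recorded A y c (u : nat) (F S : 'I_n -> int) : Prop :=
  exists J, [/\ sched A y c J S, #|J| = u, forall j, F j = (j \in J)%:Z
    & forall j, j \notin J -> S j = 0].

Lemma sched_subset A A' y c J S :
  A \subset A' -> sched A y c J S -> sched A' y c J S.
Proof. by move=> sA [sJ *]; split=> //; apply: subset_trans sA. Qed.

Lemma recorded_subset A A' y c u F S :
  A \subset A' -> recorded A y c u F S -> recorded A' y c u F S.
Proof. by move=> sA [J [/(sched_subset _ _ _ _ _ _ sA) ? *]]; exists J. Qed.

(** Both constraints that involve the left end become weaker when it moves to the left. *)
Lemma packed_earlier A s s' c u :
  s <= s' -> packed A (s' + p) c u -> packed A (s + p) c u.
Proof.
move=> le_s [J [S [[sJ y_c HJ dis] JE]]]; exists J, S; split=> //; split=> //.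
  lia.
by move=> j /HJ[]; split; lia.
Qed.

(* Jobs of the left part are released before s, those of the right part after
   s, so that no job is scheduled twice. *)
Lemma recorded_join A b y s t1 t2 l u F1 S1 F2 S2 : b \notin A ->
  recorded A y t1 l F1 S1 -> recorded A (s + p) t2 u F2 S2 ->
  t1 <= s -> tnth r b <= s -> s + p <= tnth d b -> y - p < tnth r b ->
  recorded (b |: A) y t2 (l + 1 + u)
    (fun j => F1 j + F2 j + if j == b then 1 else 0)
    (fun j => S1 j + S2 j + if j == b then s else 0).
Proof.
move=> bA [J1 [[sJ1 y1 H1 D1] C1 E1 Z1]] [J2 [[sJ2 y2 H2 D2] C2 E2 Z2]].
move=> t1s rb db yb.
have N1 : b \notin J1 by apply: contraNN bA => /(subsetP sJ1).
have N2 : b \notin J2 by apply: contraNN bA => /(subsetP sJ2).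
have dis j : j \in J1 -> j \notin J2.
  by move=> /H1[*]; apply/negP => /H2[*]; lia.
exists (b |: (J1 :|: J2)); split.
- split.
  + by rewrite setUS // subUset sJ1.
  + lia.
  + move=> j; rewrite !inE => /or3P[/eqP->|j1|j2].
    * by rewrite eqxx (Z1 _ N1) (Z2 _ N2); split; lia.
    * have -> : (j == b) = false by apply: contraNF N1 => /eqP <-.
      by rewrite Z2 ?dis //; case: (H1 _ j1); split; lia.
    * have -> : (j == b) = false by apply: contraNF N2 => /eqP <-.
      have nj1 : j \notin J1 by apply: contraTN j2; exact: dis.
      by rewrite Z1 //; case: (H2 _ j2); split; lia.
  + have V j : j \in b |: (J1 :|: J2) ->
      [\/ j = b /\ S1 j + S2 j + (if j == b then s else 0) = s,
          [/\ j \in J1, S1 j + S2 j + (if j == b then s else 0) = S1 j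
            & S1 j + p <= s]
        | [/\ j \in J2, S1 j + S2 j + (if j == b then s else 0) = S2 j
            & s + p <= S2 j]].
      rewrite !inE => /or3P[/eqP->|j1|j2].
      * by apply: Or31; rewrite eqxx (Z1 _ N1) (Z2 _ N2); split=> //; lia.
      * apply: Or32; have -> : (j == b) = false by apply: contraNF N1 => /eqP <-.
        by rewrite Z2 ?dis //; case: (H1 _ j1); split=> //; lia.
      * apply: Or33; have -> : (j == b) = false by apply: contraNF N2 => /eqP <-.
        have nj1 : j \notin J1 by apply: contraTN j2; exact: dis.
        by rewrite Z1 //; case: (H2 _ j2); split=> //; lia.
    move=> i j /V Vi /V Vj ij.
    case: Vi => [[ib ->]|[iJ -> ?]|[iJ -> ?]];
    case: Vj => [[jb ->]|[jJ -> ?]|[jJ -> ?]]; try lia.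
    * by rewrite ib jb eqxx in ij.
    * exact: D1.
    * exact: D2.
- rewrite cardsU1 !inE negb_or N1 N2 cardsU C1 C2.
  rewrite (_ : J1 :&: J2 = set0) ?cards0; first by lia.
  by apply/setP=> j; rewrite !inE; apply/negP => /andP[/dis/negP].
- move=> j; rewrite E1 E2 !inE; have [->|_] := eqVneq j b.
    by rewrite (negPf N1) (negPf N2).
  by have [/dis/negPf->|] := boolP (j \in J1); lia.
- move=> j; rewrite !inE !negb_or => /and3P[/negPf-> j1 j2].
  by rewrite Z1 ?Z2.
Qed.

(* Exchange argument: as long as a job released by the start of b comes after
   b, swap the two; b has the larger deadline. *)
Lemma sched_split A b y c J S : b \notin A ->
  (forall j, j \in A -> tnth d j <= tnth d b) ->
  sched (b |: A) y c J S -> b \in J ->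
  exists s l u, [/\ tnth r b <= s, s + p <= tnth d b & y - p < tnth r b] /\
    [/\ (l + 1 + u)%N = #|J|, packed A y s l & packed A (s + p) c u].
Proof.
move=> bA dA; have [k] := ubnP #|[set j in J | S b < S j]|.
elim: k S => // k IH S lek Sc bJ.
have [sJ y_c HJ dis] := Sc.
case: (pickP [pred j in J | (S b < S j) && (tnth r j <= S b)]) => [j|none].
  case/and3P=> jJ Sbj rj.
  have jb : (j == b) = false by apply: contraTF Sbj => /eqP->; rewrite ltxx.
  have jA : j \in A by move/subsetP: sJ => /(_ j jJ); rewrite !inE jb.
  have [? ? ? ? ?] := HJ _ jJ; have [? ? ? ? ?] := HJ _ bJ.
  have dj := dA _ jA.
  (* In the swapped schedule [b] meets its deadline because that of [j] is no larger, and [j] meets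
     its release time by the choice of [j]. As [b] moves later, fewer jobs come after it. *)
  pose S' i := if i == b then S j else if i == j then S b else S i.
  have S'j : S' j = S b by rewrite /S' jb eqxx.
  have S'b : S' b = S j by rewrite /S' eqxx.
  have S'o i : i != b -> i != j -> S' i = S i.
    by rewrite /S' => /negPf-> /negPf->.
  apply: (IH S') => //.
    apply: leq_trans (ltnSE lek); apply: proper_card.
    apply/properP; split; last first.
      by exists j; rewrite !inE jJ ?Sbj // S'b S'j -leNgt ltW.
    apply/subsetP=> i; rewrite !inE S'b => /andP[iJ]; rewrite iJ.
    have [->|ib] := eqVneq i b; first by rewrite S'b ltxx.
    have [->|ij] := eqVneq i j; first by rewrite Sbj.
    by rewrite S'o //=; lia.
  split=> //.
    move=> i iJ; have [->|ib] := eqVneq i b; first by rewrite S'b; split; lia.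
    have [->|ij] := eqVneq i j; first by rewrite S'j; split; lia.
    by rewrite S'o //; exact: HJ.
  (* [S'] is [S] composed with a transposition, so disjointness carries over by injectivity. *)
  have swap i : i \in J -> exists i', [/\ i' \in J, S' i = S i'
      & i' = if i == b then j else if i == j then b else i].
    move=> iJ; rewrite /S'; have [_|ib] := eqVneq i b; first by exists j.
    by have [_|ij] := eqVneq i j; [exists b | exists i].
  move=> i1 i2 /swap[i1' [J1 -> E1]] /swap[i2' [J2 -> E2]] i12.
  apply: dis => //; apply: contra_neq i12; rewrite E1 E2.
  have [->|n1] := eqVneq i1 b; have [->|n2] := eqVneq i2 b => //.
  - by case: eqVneq => [_ /eqP|n3 /eqP]; rewrite ?jb // eq_sym (negPf n3).
  - by case: eqVneq => [_ /eqP|n3 /eqP]; rewrite 1?eq_sym ?jb // eq_sym (negPf n3).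
  case: (eqVneq i1 j) => [->|n3]; case: (eqVneq i2 j) => [->|n4] // /eqP.
    by rewrite eq_sym (negPf n2).
  by rewrite (negPf n1).
have [? ? ? ? ?] := HJ _ bJ.
have tri i : i \in J -> i != b -> S i + p <= S b \/ S b + p <= S i.
  by move=> *; apply: dis.
(* No job after [b] is released by [S b] any more, which is the release condition for the left end
   [S b + p]. The jobs before [b] end by [S b]. *)
pose J1 := [set j in J | S j < S b]; pose J2 := [set j in J | S b < S j].
have inA i : i \in J -> S i != S b -> i \in A.
  move=> iJ; have := subsetP sJ i iJ; rewrite !inE => /orP[/eqP->|//].
  by rewrite eqxx.
exists (S b), #|J1|, #|J2|; split; split=> //.
- have -> : J = b |: (J1 :|: J2).
    apply/setP=> i; rewrite !inE; have [->|ib] := eqVneq i b; first by rewrite bJ.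
    have [iJ /=|//] := boolP (i \in J).
    by case: (tri i iJ ib); lia.
  rewrite cardsU1 !inE !ltxx !andbF cardsU.
  rewrite (_ : J1 :&: J2 = set0) ?cards0; first by lia.
  by apply/setP=> i; rewrite !inE; lia.
- exists J1, S; split=> //; split=> //.
  + by apply/subsetP=> i; rewrite !inE => /andP[iJ ?]; apply: inA; lia.
  + move=> i; rewrite !inE => /andP[iJ lti]; have [] := HJ _ iJ.
    have ib : i != b by apply: contraTneq lti => ->; rewrite ltxx.
    by case: (tri i iJ ib); split; lia.
  + by move=> i j; rewrite !inE => /andP[? _] /andP[? _]; exact: dis.
- exists J2, S; split=> //; split=> //.
  + by apply/subsetP=> i; rewrite !inE => /andP[iJ ?]; apply: inA; lia.
  + move=> i; rewrite !inE => /andP[iJ lti]; have [] := HJ _ iJ.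
    have ib : i != b by apply: contraTneq lti => ->; rewrite ltxx.
    have := none i; rewrite /= iJ /=.
    by case: (tri i iJ ib); split; lia.
  + by move=> i j; rewrite !inE => /andP[? _] /andP[? _]; exact: dis.
Qed.

(** * The recurrence for the least completion times *)

Variable low : int.

(* The points r_i + m p; the extra index i = n stands for a lower bound of all
   release times. *)
Definition theta (i m : nat) : int :=
  (if (i < n)%N then nth 0 r i else low) + p *+ m.

(** The last digit in base n + 1 is left free for u, so [code i m + u] is the position of the state
    (i, m, u) in a layer. Adding n + 1 to a code adds p to the value it stands for. *)
Definition code (i m : nat) : nat := (i * (n.+1 * n.+1) + m * n.+1)%N.

(* A table entry t is 0 if no c satisfies P, and otherwise 1 + the code of the
   least such c. *)
Definition best (P : int -> Prop) A (i m u : nat) (t : int)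
    (F S : 'I_n -> int) : Prop :=
  (t = 0 /\ forall c, ~ P c) \/
  exists i' m', [/\ (i' <= n)%N, (m' <= m + u)%N, t = (code i' m').+1%:Z,
    recorded A (theta i m) (theta i' m') u F S
    & forall c, P c -> theta i' m' <= c].

Definition entry A (i m u : nat) : int -> ('I_n -> int) -> ('I_n -> int) -> Prop :=
  best (fun c => packed A (theta i m) c u) A i m u.

(** The candidate with [l] jobs before [b]. The start [s] is left free, so that any schedule split
    around [b] is covered. *)
Definition joined A (b : 'I_n) y (u l : nat) c : Prop :=
  exists s, [/\ tnth r b <= s, s + p <= tnth d b, packed A y s l
    & packed A (s + p) c (u - l.+1)].

(** What has been examined before round [l] of the innermost loop. That loop goes on up to n
    whatever [u] is, hence the [minn]. *)
Definition candidate A b y u l c : Prop :=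
  packed A y c u \/ exists2 l', (l' < minn l u)%N & joined A b y u l' c.

Lemma theta_nat i m : (i < n)%N -> theta i m = nth 0 r i + p *+ m.
Proof. by rewrite /theta => ->. Qed.

Lemma thetaS i m : theta i m.+1 = theta i m + p.
Proof. by rewrite /theta mulrSr addrA. Qed.

Lemma best_iff P Q A i m u t F S :
  (forall c, P c <-> Q c) -> best P A i m u t F S -> best Q A i m u t F S.
Proof.
move=> PQ [[-> H]|[i' [m' [*]]]]; [left|right]; first by split=> // c /PQ /H.
by exists i', m'; split=> // c /PQ; auto.
Qed.

Lemma best_ext P A i m u t F S F' S' : F =1 F' -> S =1 S' ->
  best P A i m u t F S -> best P A i m u t F' S'.
Proof.
move=> EF ES [H|[i' [m' [? ? ? [J [[? ? H D] ? HF HS]] ?]]]]; [by left|right].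
exists i', m'; split=> //; exists J; split=> //.
- split=> // [j /H|j j' jJ j'J jj']; first by rewrite -ES.
  by rewrite -!ES; exact: D.
- by move=> j; rewrite -EF.
- by move=> j jJ; rewrite -ES HS.
Qed.

Lemma best_subset P A A' i m u t F S : A \subset A' ->
  best P A i m u t F S -> best P A' i m u t F S.
Proof.
move=> sA [H|[i' [m' [? ? ? /(recorded_subset _ _ _ _ _ _ _ sA) ? ?]]]].
  by left.
by right; exists i', m'.
Qed.

Lemma packed0 A y c : y <= c -> packed A y c 0.
Proof.
move=> yc; exists set0, (fun=> 0); rewrite cards0; split=> //.
by split=> // [|j|i j]; rewrite ?sub0set ?inE.
Qed.

Lemma recorded0 A y c F S : recorded A y c 0 F S -> F =1 (fun=> 0) /\ S =1 (fun=> 0).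
Proof.
case=> J [_ /eqP]; rewrite cards_eq0 => /eqP-> HF HS.
by split=> j; [rewrite HF inE | rewrite HS ?inE].
Qed.

(** An entry for zero jobs is neutral under addition of schedules. The program takes it as second
    summand when [b] is left out. *)
Lemma entry0 A i m t F S : entry A i m 0 t F S -> F =1 (fun=> 0) /\ S =1 (fun=> 0).
Proof.
case=> [[_ /(_ (theta i m))[]]|[i' [m' [_ _ _ /recorded0]]]] //.
exact: packed0.
Qed.

Lemma entry_set0 i m u : (i <= n)%N ->
  entry set0 i m u (if (0 < u)%N then 0 else (code i m).+1%:Z) (fun=> 0) (fun=> 0).
Proof.
move=> i_n; have [u_gt0|] := ltnP 0 u.
  left; split=> // c [J [S [[]]]]; rewrite subset0 => /eqP-> _ _ _.
  by rewrite cards0; lia.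
rewrite leqn0 => /eqP->; right; exists i, m; split=> //; first by rewrite addn0.
  exists set0; rewrite cards0; split=> // [|j]; rewrite ?inE //.
  by split=> [||j|k j]; rewrite ?sub0set ?inE.
by move=> c [J [S [[]]]].
Qed.

Lemma candidateS A b y u l c : (l < u)%N ->
  candidate A b y u l.+1 c <-> candidate A b y u l c \/ joined A b y u l c.
Proof.
move=> lu; split=> [[|[l' l'u H]]|[[|[l' l'u H]]|H]].
- by left; left.
- have [E|ll'] := eqVneq l' l; first by right; rewrite -E.
  by left; right; exists l' => //; lia.
- by left.
- by right; exists l' => //; lia.
- by right; exists l => //; lia.
Qed.

Lemma candidate_ge A b y u l c : (u <= l)%N ->
  candidate A b y u l.+1 c <-> candidate A b y u l c.
Proof. by move=> ul; rewrite /candidate !(minn_idPr _) //; lia. Qed.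

Lemma candidate0 A b y u c : candidate A b y u 0 c <-> packed A y c u.
Proof. by split=> [[//|[l']]|]; [rewrite min0n|left]. Qed.

(** A schedule that avoids [b] is one for [A]; any other is split around [b], where the release
    condition on [b] is forced. *)
Lemma candidate_packed A b y u l c : b \notin A ->
  (forall j, j \in A -> tnth d j <= tnth d b) -> (u <= l)%N ->
  packed (b |: A) y c u ->
  packed A y c u \/ y - p < tnth r b /\ candidate A b y u l c.
Proof.
move=> bA dA ul [J [S [Sc JE]]].
have [bJ|bJ] := boolP (b \in J); last first.
  left; exists J, S; split=> //; case: Sc => sJ *; split=> //.
  apply/subsetP=> j jJ; have := subsetP sJ j jJ; rewrite !inE.
  by case: eqVneq jJ bJ => [-> ->|].
have [s [l' [u' [[rb db yb]]]]] := sched_split A b y c J S bA dA Sc bJ.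
rewrite JE => -[uE P1 P2]; right; split=> //; right.
exists l'; first by lia.
by exists s; split=> //; rewrite (_ : u - l'.+1 = u')%N; last lia.
Qed.

(** The value found is attained by the recorded schedule, so only the inclusion of the schedules in
    the candidates has to be shown. *)
Lemma best_candidate A b i m u l t F S : b \notin A ->
  (forall j, j \in A -> tnth d j <= tnth d b) -> (u <= l)%N ->
  best (candidate A b (theta i m) u l) (b |: A) i m u t F S ->
  entry (b |: A) i m u t F S.
Proof.
move=> bA dA ul.
have C c : packed (b |: A) (theta i m) c u -> candidate A b (theta i m) u l c.
  by case/(candidate_packed _ _ _ _ l _ bA dA ul) => [?|[]]; [left|].
case=> [[-> H]|[i' [m' [? ? ? ? H]]]].
  by left; split=> // c /C /H.
by right; exists i', m'; split=> // c /C /H.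
Qed.

(** Here the release condition excludes [b], and the entry of the previous layer stays valid. *)
Lemma best_unreleased A b i m u t F S : b \notin A ->
  (forall j, j \in A -> tnth d j <= tnth d b) -> tnth r b <= theta i m - p ->
  best (fun c => packed A (theta i m) c u) (b |: A) i m u t F S ->
  entry (b |: A) i m u t F S.
Proof.
move=> bA dA rb.
have C c : packed (b |: A) (theta i m) c u -> packed A (theta i m) c u.
  by case/(candidate_packed _ _ _ _ u _ bA dA (leqnn u)) => [//|[]]; lia.
case=> [[-> H]|[i' [m' [? ? ? ? H]]]].
  by left; split=> // c /C /H.
by right; exists i', m'; split=> // c /C /H.
Qed.

(* If b starts at s after the best left part, then s is the least possible
   start, which also leaves the most room for the right part. *)
Lemma joined_least A b y u l t s c :
  (forall c, packed A y c l -> t <= c) -> s = Num.max (tnth r b) t ->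
  joined A b y u l c -> s + p <= tnth d b /\ packed A (s + p) c (u - l.+1).
Proof.
move=> lb ->; case=> s' [rb db /lb ts' P].
have ss : Num.max (tnth r b) t <= s' by rewrite ge_max rb.
by split; [lia | exact: packed_earlier P].
Qed.
End Combinatorics.

(** * The program *)

Declare Scope prog_scope.
Delimit Scope prog_scope with prog.
Bind Scope prog_scope with exp stmt.
Coercion Var : nat >-> exp.
Notation "e1 + e2" := (Plus e1 e2) : prog_scope.
Notation "e1 - e2" := (Minus e1 e2) : prog_scope.
Notation "x <- e" := (Asg x e) (at level 85, no associativity) : prog_scope.
Notation "c1 ;; c2" := (Seq c1 c2) (at level 90, right associativity) : prog_scope.

Section Program.

(* Registers: n, p, N = n + 1 and its powers, a lower bound of the release
   times; loop counters i, m, u, l, j and the current position pos in the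
   table; the job b joining the layer that starts at old, with its data and
   the code of (b, 0); the code q of (i, m); the best entry so far, as the
   sum of the schedules at c1 and c2, plus b at start if ad = 1. *)
Local Notation rn := 0%N (only parsing).
Local Notation rp := 1%N (only parsing).
Local Notation rN := 2%N (only parsing).
Local Notation rN2 := 3%N (only parsing).
Local Notation rN3 := 4%N (only parsing).
Local Notation rN4 := 5%N (only parsing).
Local Notation low := 6%N (only parsing).
Local Notation ri := 7%N (only parsing).
Local Notation rm := 8%N (only parsing).
Local Notation ru := 9%N (only parsing).
Local Notation rl := 10%N (only parsing).
Local Notation rj := 11%N (only parsing).
Local Notation pos := 12%N (only parsing).
Local Notation old := 13%N (only parsing).
Local Notation rb := 14%N (only parsing).
Local Notation rel := 15%N (only parsing).
Local Notation due := 16%N (only parsing).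
Local Notation qb := 17%N (only parsing).
Local Notation q := 18%N (only parsing).
Local Notation bst := 19%N (only parsing).
Local Notation c1 := 20%N (only parsing).
Local Notation c2 := 21%N (only parsing).
Local Notation ad := 22%N (only parsing).
Local Notation start := 23%N (only parsing).
Local Notation t1 := 24%N (only parsing).
Local Notation qs := 25%N (only parsing).
Local Notation t2 := 26%N (only parsing).
Local Notation g := 27%N (only parsing).
Local Notation rk := 28%N (only parsing).

(* Arrays: input/output, values of codes, table entries, flags and starts of
   the stored schedules, marks of the jobs already treated, and tables of the
   multiples of N^2 and N^4.  The entry for u jobs from (i, m) in the k-th
   layer is at x = k N^3 + i N^2 + m N + u, and the data of job j in its
   schedule at j N^4 + x. *)
Local Notation aio := 0%N (only parsing).
Local Notation aV := 1%N (only parsing).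
Local Notation aT := 2%N (only parsing).
Local Notation aF := 3%N (only parsing).
Local Notation aS := 4%N (only parsing).
Local Notation aD := 5%N (only parsing).
Local Notation aB := 6%N (only parsing).
Local Notation aJ := 7%N (only parsing).

Local Notation skip := (Asg g (Cst 0)) (only parsing).

(** Each power is the previous one added n + 1 times to a register that is initially 0. *)
Definition powers : stmt :=
  (rN <- rn + Cst 1;;
   For ri true (rN2 <- rN2 + rN);;
   For ri true (rN3 <- rN3 + rN2);;
   For ri true (rN4 <- rN4 + rN3))%prog.

(** The register starts at 0, so the result may lie below all release times; any lower bound will
    do. *)
Definition lower_bound : stmt :=
  (For rj false (If (low - Get aio rj) (low <- Get aio rj) skip))%prog.

Definition strides : stmt :=
  (q <- Cst 0;;
   For rj false (Put aJ rj q;; q <- q + rN4))%prog.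

Definition values : stmt :=
  (q <- Cst 0;;
   For ri true
    (Put aB ri q;;
     If (rn - ri) (start <- Get aio ri) (start <- low);;
     For rm true (Put aV q start;; start <- start + rp;; q <- q + rN)))%prog.

Definition bottom : stmt :=
  (pos <- Cst 0;;
   For ri true (For rm true (For ru true
    (If ru (Put aT pos (Cst 0)) (Put aT pos (pos + Cst 1));;
     pos <- pos + Cst 1))))%prog.

(** A linear scan per layer takes the place of sorting by deadline. The test of the mark of [rb]
    deals with its initial value 0, which may be a job already treated. *)
Definition select : stmt :=
  (rb <- Cst 0;;
   For rj false
     (If (Get aD rj) skip
     (If (Get aD rb) (rb <- rj)
     (If (Get aio (rn + rb) - Get aio (rn + rj)) (rb <- rj) skip)));;
   Put aD rb (Cst 1);;
   rel <- Get aio rb;;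
   due <- Get aio (rn + rb);;
   qb <- Get aB rb)%prog.

(** The start of [b] is the maximum of its release time and of the completion time of the left part.
    It is kept as a code [qs], so that [qs + rN] is the code of the left end of the right part. A
    positive [g] means that the new completion time is strictly better or the first one found. *)
Definition attempt : stmt :=
  (t1 <- Get aT (old + q + rl);;
   If t1
    (If (Get aV (t1 - Cst 1) - rel) (qs <- t1 - Cst 1) (qs <- qb);;
     If (due - Get aV (qs + rN) + Cst 1)
      (t2 <- Get aT (old + qs + rN + (ru - rl - Cst 1));;
       If t2
        (g <- Cst 1;;
         If bst (g <- Get aV (bst - Cst 1) - Get aV (t2 - Cst 1)) (g <- Cst 1);;
         If g
          (bst <- t2;;
           c1 <- old + q + rl;;
           c2 <- old + qs + rN + (ru - rl - Cst 1);;
           ad <- Cst 1;;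
           start <- Get aV qs)
          skip)
        skip)
      skip)
    skip)%prog.

(** The same state in the previous layer lies at [pos - rN3]. The initial choice leaves [b] out: its
    schedule is the one stored there plus the empty one of the state (i, m, 0). The test before the
    loop is the release condition on [b]. *)
Definition search : stmt :=
  (q <- pos - rN3 - old - ru;;
   bst <- Get aT (pos - rN3);;
   c1 <- pos - rN3;;
   c2 <- old + q;;
   ad <- Cst 0;;
   start <- Cst 0;;
   If (rel - Get aV q + rp)
     (For rl true (If (ru - rl) attempt skip))
     skip)%prog.

(** The copying loop stands beside the loop over [rl], not inside it, so the O(n) cost of storing a
    schedule does not raise the depth. *)
Definition record : stmt :=
  (Put aT pos bst;;
   For rj false
    (Put aF (Get aJ rj + pos)
       (Get aF (Get aJ rj + c1) + Get aF (Get aJ rj + c2));;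
     Put aS (Get aJ rj + pos)
       (Get aS (Get aJ rj + c1) + Get aS (Get aJ rj + c2)));;
   Put aF (Get aJ rb + pos) (Get aF (Get aJ rb + pos) + ad);;
   Put aS (Get aJ rb + pos) (Get aS (Get aJ rb + pos) + start);;
   pos <- pos + Cst 1)%prog.

Definition layer : stmt :=
  (For ri true (For rm true (For ru true (search;; record))))%prog.

(** The row with i = n and m = 0 starts at a lower bound of all release times, where the release
    condition is void. The scan keeps the largest number of jobs with a nonzero entry. *)
Definition answer : stmt :=
  (q <- old + Get aB rn;;
   c2 <- Cst 0;;
   For ru true (If (Get aT (q + ru)) (c2 <- ru) skip);;
   c1 <- q + c2;;
   For rj false
    (Put aio rj (Get aF (Get aJ rj + c1));;
     Put aio (rn + rj) (Get aS (Get aJ rj + c1))))%prog.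

Definition scheduler : stmt :=
  (powers;; lower_bound;; strides;; values;; bottom;;
   old <- Cst 0;;
   For rk false (select;; layer;; old <- old + rN3);;
   answer)%prog.

End Program.

(** * Verification of the program *)

Definition width3 (n : nat) : nat := (n.+1 * (n.+1 * n.+1))%N.
(** The size of the n + 1 layers together, each of size [width3 n]; it is the distance between the
    data of consecutive jobs. *)
Definition width4 (n : nat) : nat := (n.+1 * (n.+1 * (n.+1 * n.+1)))%N.

Lemma codeE n i m : code n i m = ((i * n.+1 + m) * n.+1)%N.
Proof. by rewrite /code; lia. Qed.

Lemma code_lt n i m u : (i <= n)%N -> (m <= n)%N -> (u <= n)%N ->
  (code n i m + u < width3 n)%N.
Proof. by rewrite /code /width3; nia. Qed.

Lemma code_inj n i m u i' m' u' : (m <= n)%N -> (u <= n)%N ->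
  (m' <= n)%N -> (u' <= n)%N ->
  (code n i m + u)%N = (code n i' m' + u')%N -> [/\ i = i', m = m' & u = u'].
Proof.
move=> mn un mn' un'.
rewrite !codeE => /[dup] /(congr1 (divn^~ n.+1)) E /(congr1 (modn^~ n.+1)).
rewrite !modnMDl !modn_small // => ->.
move: E; rewrite !divnMDl // !divn_small // !addn0.
move=> /[dup] /(congr1 (divn^~ n.+1)) E /(congr1 (modn^~ n.+1)).
rewrite !modnMDl !modn_small // => ->.
by move: E; rewrite !divnMDl // !divn_small // !addn0 => ->.
Qed.

Lemma digits_eq w j x j' x' : (x < w)%N -> (x' < w)%N ->
  (j * w + x == j' * w + x')%N = (j == j') && (x == x').
Proof.
move=> xw xw'; apply/eqP/andP => [E|[/eqP-> /eqP->] //].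
have /eqP := congr1 (divn^~ w) E; have /eqP := congr1 (modn^~ w) E.
rewrite /= !modnMDl !modn_small // => ->.
by rewrite !divnMDl ?divn_small ?addn0 //; lia.
Qed.

Lemma slotE n k v (x : nat) : v = x%:Z -> k != 0%N -> slot n k v = x.
Proof. by move=> -> /negPf k0; rewrite /slot k0. Qed.

Lemma slot0E n v (x : nat) : v = x%:Z -> (x <= n + n)%N -> slot n 0 v = x.
Proof. by move=> -> xn; rewrite /slot /=; lia. Qed.

Lemma powers_spec n s : var s 0 = n%:Z -> var s 3 = 0 -> var s 4 = 0 -> var s 5 = 0 ->
  wp n powers (fun s' => [/\ var s' 2 = n.+1%:Z, var s' 3 = (n.+1 * n.+1)%N%:Z,
    var s' 4 = (width3 n)%:Z & var s' 5 = (width4 n)%:Z]) s.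
Proof.
move=> s0 s3 s4 s5; rewrite /powers; apply: wp_seq; apply: wp_asg => v2 /= v2E.
apply: wp_seq; apply: (@wp_for _ _ _ _ (fun i s' => var s' 3 = (i * n.+1)%N%:Z)) => //.
  by move=> i s1 _ [HV _] _ I1; apply: wp_asg => v /= ->;
    rewrite (HV 2%N) //= I1 v2E s0; lia.
move=> s1 [HV1 _] I1.
apply: wp_seq; apply: (@wp_for _ _ _ _ (fun i s' =>
  var s' 4 = (i * (n.+1 * n.+1))%N%:Z)) => //.
- by rewrite /= HV1.
- move=> i s2 _ [HV _] _ I2; apply: wp_asg => v /= ->.
  by rewrite (HV 3%N) //= I1 I2 addn1; lia.
move=> s2 [HV2 _] I2.
apply: (@wp_for _ _ _ _ (fun i s' => var s' 5 = (i * width3 n)%N%:Z)) => //.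
- by rewrite /= HV2 //= HV1.
- move=> i s3' _ [HV _] _ I3; apply: wp_asg => v /= ->.
  by rewrite (HV 4%N) //= I2 I3 addn1 /width3; lia.
move=> s3' [HV3 _] I3; rewrite !addn1 in I1 I2 I3.
split.
- by rewrite HV3 // HV2 // HV1 //= v2E s0; lia.
- by rewrite HV3 // HV2.
- by rewrite HV3.
- by [].
Qed.

Lemma lower_bound_spec n (r : n.-tuple int) s : (forall j : 'I_n, arr s 0 j = tnth r j) ->
  wp n lower_bound (fun s' => forall j : 'I_n, var s' 6 <= tnth r j) s.
Proof.
move=> sr; rewrite /lower_bound.
apply: (@wp_for _ _ _ _ (fun l s' =>
  forall j : 'I_n, (j < l)%N -> var s' 6 <= tnth r j)) => //; last first.
  by move=> s1 _ H j; apply: H; rewrite addn0.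
move=> l s1; rewrite addn0 => ln [_ HA] s1l I1.
have rE : arr s1 0 (slot n 0 (var s1 11)) = tnth r (Ordinal ln).
  by rewrite (slot0E n _ _ s1l) ?HA ?(sr (Ordinal ln)) //; lia.
apply: wp_if => /=; rewrite rE => cmp; apply: wp_asg => v /= vE j;
  rewrite ltnS leq_eqVlt => /orP[/eqP jl|jl].
- by rewrite vE rE (_ : j = Ordinal ln) //; apply: val_inj.
- by rewrite vE rE; have := I1 j jl; lia.
- by rewrite (_ : j = Ordinal ln); [lia | apply: val_inj].
- exact: I1.
Qed.

Lemma strides_spec n s : var s 5 = (width4 n)%:Z ->
  wp n strides (fun s' => forall j, (j < n)%N -> arr s' 7 j = (j * width4 n)%N%:Z) s.
Proof.
move=> s5; rewrite /strides; apply wp_seq; apply: wp_asg => ? /= ->.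
apply: (@wp_for _ _ _ _ (fun l s' => var s' 18 = (l * width4 n)%N%:Z /\
  forall j, (j < l)%N -> arr s' 7 j = (j * width4 n)%N%:Z)) => //; last first.
  by move=> s1 _ [_ H] j jn; apply: H; rewrite addn0.
move=> l s1; rewrite addn0 => ln [HV _] s1l [q1 I1].
apply: wp_seq; apply: wp_put => _ _ /= -> ->; apply: wp_asg => ? /= ->.
rewrite (slotE n 7 _ _ s1l) //; split=> /=.
  by rewrite (HV 5%N) //= s5 q1; lia.
move=> j; rewrite ltnS leq_eqVlt => /orP[/eqP->|jl]; first by rewrite eqxx.
by rewrite ltn_eqF // I1.
Qed.

Section Scheduler.
Variables (n : nat) (p : int) (r d : n.-tuple int) (L : int).
Hypothesis p_gt0 : 0 < p.
Implicit Types (A : {set 'I_n}) (s : store).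

Record env s : Prop := Env {
  env_n : var s 0 = n%:Z;
  env_p : var s 1 = p;
  env_N : var s 2 = n.+1%:Z;
  env_N2 : var s 3 = (n.+1 * n.+1)%N%:Z;
  env_N3 : var s 4 = (width3 n)%:Z;
  env_N4 : var s 5 = (width4 n)%:Z;
  env_low : var s 6 = L;
  env_r : forall j : 'I_n, arr s 0 j = tnth r j;
  env_d : forall j : 'I_n, arr s 0 (n + j) = tnth d j;
  env_V : forall i m, (i <= n)%N -> (m <= n)%N ->
    arr s 1 (code n i m) = theta n p r L i m;
  env_B : forall i, (i <= n)%N -> arr s 6 i = (code n i 0)%:Z;
  env_J : forall j, (j < n)%N -> arr s 7 j = (j * width4 n)%N%:Z }.

Lemma env_ext s s' : (forall x, (x < 7)%N -> var s' x = var s x) ->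
  (forall k, k \in [:: 0; 1; 6; 7]%N -> forall i, arr s' k i = arr s k i) ->
  env s -> env s'.
Proof. by move=> HV HA [*]; split=> *; rewrite ?HV ?HA //; auto. Qed.

Lemma env_unchanged c s s' : unchanged c s s' ->
  all (fun x => x \notin mods c) (iota 0 7) ->
  all (fun k => k \notin amods c) [:: 0; 1; 6; 7]%N ->
  env s -> env s'.
Proof.
move=> [HV HA] /allP cV /allP cA; apply: env_ext => [x x7|k kin].
  by rewrite HV // cV // mem_iota.
by apply: HA; exact: cA.
Qed.

Definition row (s : store) (k x : nat) (j : 'I_n) : int :=
  arr s k (j * width4 n + x)%N.

(** The restriction to [m + u <= n] is preserved by the recurrence and keeps every multiple of p
    within one digit. *)
Definition filled s A (base lim : nat) : Prop :=
  forall i m u, (i <= n)%N -> (m + u <= n)%N -> (code n i m + u < lim)%N ->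
  entry n p r d L A i m u (arr s 2 (base + (code n i m + u))%N)
    (row s 3 (base + (code n i m + u))) (row s 4 (base + (code n i m + u))).

(* For the flags (k = 3) v says whether b is added, for the starts (k = 4) it is
   the start of b. *)
Definition total s (k x1 x2 : nat) (b : 'I_n) (v : int) (j : 'I_n) : int :=
  row s k x1 j + row s k x2 j + (if j == b then v else 0).

Record joining A (b : 'I_n) (base i m u : nat) s : Prop := Joining {
  joining_env : env s;
  joining_filled : filled s A base (width3 n);
  joining_old : var s 13 = base%:Z;
  joining_job : var s 14 = (b : nat)%:Z;
  joining_rel : var s 15 = tnth r b;
  joining_due : var s 16 = tnth d b;
  joining_qb : var s 17 = (code n b 0)%:Z;
  joining_u : var s 9 = u%:Z;
  joining_pos : var s 12 = (base + width3 n + (code n i m + u))%N%:Z }.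

(** Registers 19 to 23 are [bst], [c1], [c2], [ad] and [start]. The bounds on [x1] and [x2] place
    the two summands in earlier layers, away from the cell about to be written. *)
Definition found (P : int -> Prop) A (b : 'I_n) (base i m u : nat) s : Prop :=
  exists x1 x2 : nat, [/\ var s 20 = x1%:Z, var s 21 = x2%:Z,
    (x1 < base + width3 n)%N, (x2 < base + width3 n)%N
    & best n p r d L P (b |: A) i m u (var s 19)
        (total s 3 x1 x2 b (var s 22)) (total s 4 x1 x2 b (var s 23))].

Lemma filled_ext s s' A base lim : (forall k, k \in [:: 2; 3; 4]%N ->
    forall x, arr s' k x = arr s k x) ->
  filled s A base lim -> filled s' A base lim.
Proof.
move=> H Fl i m u i_n mu /(Fl i m u i_n mu); rewrite H //.
by apply: best_ext => j; rewrite /row H.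
Qed.

Lemma joining_ext A b base i m u s s' :
  (forall x, (x < 18)%N -> x \notin [:: 7; 8; 10; 11]%N -> var s' x = var s x) ->
  (forall k, k != 5%N -> forall i, arr s' k i = arr s k i) ->
  joining A b base i m u s -> joining A b base i m u s'.
Proof.
move=> HV HA [E Fl *]; split; rewrite ?HV //.
  by apply: env_ext E => [x x7|k]; [apply: HV | rewrite !inE => ?; apply: HA];
    rewrite ?inE; lia.
by apply: filled_ext Fl => k; rewrite !inE => ? x; rewrite HA //; lia.
Qed.

Lemma joining_unchanged c A b base i m u s s' : unchanged c s s' ->
  all (fun x => (18 <= x)%N || (x \in [:: 7; 8; 10; 11]%N)) (mods c) ->
  all (pred1 5%N) (amods c) ->
  joining A b base i m u s -> joining A b base i m u s'.
Proof.
move=> [HV HA] /allP cV /allP cA; apply: joining_ext => [x x18 xn|k k5].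
  by apply: HV; apply: contra xn => /cV; lia.
by apply: HA; apply: contra k5 => /cA.
Qed.

Lemma found_iff P Q A b base i m u s : (forall c, P c <-> Q c) ->
  found P A b base i m u s -> found Q A b base i m u s.
Proof.
move=> PQ [x1 [x2 [H1 H2 H3 H4 H5]]]; exists x1, x2; split=> //.
by apply: best_iff H5.
Qed.

Lemma attempt_spec A b base i m u l s : joining A b base i m u s ->
  b \notin A -> (forall j, j \in A -> tnth d j <= tnth d b) ->
  theta n p r L i m - p < tnth r b ->
  (i <= n)%N -> (m + u <= n)%N -> (l < u)%N ->
  var s 18 = (code n i m)%:Z -> var s 10 = l%:Z ->
  found (candidate n p r d A b (theta n p r L i m) u l) A b base i m u s ->
  wp n attempt
    (found (candidate n p r d A b (theta n p r L i m) u l.+1) A b base i m u) s.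
Proof.
move=> J bA dA rb i_n mu lu sq sl Fs.
have [E Fl sold _ srel sdue sqb su _] := J.
have Hl : (code n i m + l < width3 n)%N by apply: code_lt; lia.
have El := Fl i m l i_n ltac:(lia) Hl.
rewrite /attempt; apply: wp_seq; apply: wp_asg => t1 /= Et1.
rewrite (slotE n 2 _ (base + (code n i m + l))) // in Et1; last by rewrite sold sq sl; lia.
rewrite -Et1 in El.
have same_found P s' : found P A b base i m u s -> arr s' = arr s ->
   (forall x, x \in [:: 19; 20; 21; 22; 23]%N -> var s' x = var s x) ->
   found P A b base i m u s'.
  by move=> H Ha Hv; rewrite /found /total /row Ha !Hv.
(* If round [l] admits no joined schedule, the previous best remains valid for [l + 1]. *)
have noop s' : (forall c, ~ joined n p r d A b (theta n p r L i m) u l c) ->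
   arr s' = arr s ->
   (forall x, x \in [:: 19; 20; 21; 22; 23]%N -> var s' x = var s x) ->
   found (candidate n p r d A b (theta n p r L i m) u l.+1) A b base i m u s'.
  move=> none Ha Hv; apply: same_found Ha Hv; apply: found_iff Fs => c.
  by rewrite candidateS //; split; [left | case=> // /none].
apply: wp_if => /= t1_pos; last first.
  apply: wp_asg => v _; apply: noop => // [c [s' [_ _ P _]]|x].
    by case: El => [[_ /(_ s')]|[i1 [m1 [_ _ t1E]]]] //; rewrite t1E in t1_pos.
  by rewrite !inE => /or4P[|||/orP[]] /eqP->.
case: El => [[? _]|[i1 [m1 [i1n m1l t1E R1 lb1]]]]; first by lia.
(* The start of [b] is again a tabulated value: either that of the left part's completion or r_b
   itself, with multiple 0. *)
apply: wp_seq; apply: (@wp_weaken _ _ (fun s' => exists i0 m0, [/\ (i0 <= n)%N,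
    (m0 <= m + l)%N, theta n p r L i0 m0 = Num.max (tnth r b) (theta n p r L i1 m1)
    & s' = setv (setv s 24 t1) 25 (code n i0 m0)%:Z])).
  have V1 : arr s 1 (slot n 1 (t1 - 1)) = theta n p r L i1 m1.
    by rewrite (slotE n 1 _ (code n i1 m1)) ?(env_V s) //; lia.
  apply: wp_if => /=; rewrite V1 srel => cmp; apply: wp_asg => ? /= ->.
    exists i1, m1; split=> //; first by rewrite max_r //; lia.
    by congr setv; lia.
  exists b, 0%N; split=> //; first by rewrite ltnW.
    by rewrite theta_nat // mulr0n addr0 -tnth_nth max_l //; lia.
  by rewrite sqb.
move=> _ _ [i0 [m0 [i0n m0l v0 ->]]].
have m0n : (m0.+1 <= n)%N by lia.
have Vd : arr s 1 (slot n 1 ((code n i0 m0)%:Z + var s 2)) = theta n p r L i0 m0 + p.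
  rewrite (slotE n 1 _ (code n i0 m0.+1)) ?(env_V s) ?thetaS //.
  by rewrite (env_N s) // /code; lia.
apply: wp_if => /=; rewrite Vd sdue => in_time; last first.
  apply: wp_asg => v _; apply: noop => // [c H|x].
    by have [] := joined_least n p r d p_gt0 _ _ _ _ _ _ _ _ lb1 v0 H; lia.
  by rewrite !inE => /or4P[|||/orP[]] /eqP->.
set u2 := (u - l.+1)%N.
have H2 : (code n i0 m0.+1 + u2 < width3 n)%N by apply: code_lt; lia.
(* This entry is meaningful: [m0 + 1 + u2 <= m + l + 1 + (u - l - 1) = m + u <= n]. *)
have E2 := Fl i0 m0.+1 u2 i0n ltac:(lia) H2.
apply: wp_seq; apply: wp_asg => t2 /= Et2.
have idx2 : var s 13 + code n i0 m0 + var s 2 + (var s 9 - var s 10 - 1)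
    = (base + (code n i0 m0.+1 + u2))%N%:Z.
  by rewrite sold su sl (env_N s) // /code /u2; lia.
rewrite (slotE n 2 _ _ idx2) // in Et2; rewrite -Et2 in E2.
apply: wp_if => /= t2_pos; last first.
  apply: wp_asg => v _; apply: noop => // [c H|x].
    have [_] := joined_least n p r d p_gt0 _ _ _ _ _ _ _ _ lb1 v0 H.
    rewrite -thetaS; case: E2 => [[_ H0 /H0] //|[i2 [m2 [_ _ t2E]]]].
    by rewrite t2E in t2_pos.
  by rewrite !inE => /or4P[|||/orP[]] /eqP->.
case: E2 => [[? _]|[i2 [m2 [i2n m2l t2E R2 lb2]]]]; first by lia.
have V2 : arr s 1 (slot n 1 (t2 - 1)) = theta n p r L i2 m2.
  by rewrite (slotE n 1 _ (code n i2 m2)) ?(env_V s) //; lia.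
have joined_ge c : joined n p r d A b (theta n p r L i m) u l c ->
    theta n p r L i2 m2 <= c.
  move=> H; have [_] := joined_least n p r d p_gt0 _ _ _ _ _ _ _ _ lb1 v0 H.
  by rewrite -thetaS; exact: lb2.
apply: wp_seq; apply: wp_asg => g0 /= g0E.
set s1 := setv _ 27 g0.
have [x1 [x2 [c1E c2E x1w x2w B]]] := Fs.
(* A positive test puts the new completion time below all earlier candidates; otherwise the current
   best is at most the new one. *)
apply: wp_seq; apply: (@wp_weaken _ _ (fun s' => exists g1, s' = setv s1 27 g1 /\
   if 0 < g1 then forall c, candidate n p r d A b (theta n p r L i m) u l c ->
       theta n p r L i2 m2 <= c
   else exists i3 m3, [/\ (i3 <= n)%N, (m3 <= m + u)%N, 
      var s 19 = (code n i3 m3).+1%:Z & theta n p r L i3 m3 <= theta n p r L i2 m2])).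
  apply: wp_if => /= cmp; apply: wp_asg => g1 /= g1E; exists g1; split=> //.
    case: B => [[? _]|[i3 [m3 [i3n m3l t3E _ lb3]]]]; first by lia.
    rewrite V2 (slotE n 1 _ (code n i3 m3)) ?(env_V s) // in g1E; try lia.
    case: ifP => g1_pos; last by exists i3, m3; split=> //; lia.
    by move=> c /lb3; lia.
  rewrite g1E /= => c Hc; case: B => [[_ /(_ c)[]]|[i3 [m3 [_ _ t3E]]]] //.
  by rewrite t3E in cmp.
move=> _ _ [g1 [-> Hg]].
apply: wp_if => /= => g1_pos; last first.
  rewrite leNgt in g1_pos; rewrite (negPf g1_pos) in Hg.
  case: Hg => i3 [m3 [i3n m3l t3E le32]].
  apply: wp_asg => v _; exists x1, x2; split=> //=.
  case: B => [[? _]|[i4 [m4 [i4n m4l t4E R4 lb4]]]]; first by lia.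
  right; exists i4, m4; split=> // c; rewrite candidateS // => -[/lb4 //|/joined_ge].
  have [|-> -> _] := code_inj n i4 m4 0 i3 m3 0 ltac:(lia) (leq0n _) ltac:(lia) (leq0n _); lia.
rewrite g1_pos in Hg.
do 5 (try apply: wp_seq; apply: wp_asg => ? /= ->).
exists (base + (code n i m + l))%N, (base + (code n i0 m0.+1 + u2))%N.
split=> /=; first by rewrite sold sq sl; lia.
- by rewrite idx2.
- by rewrite ltn_add2l.
- by rewrite ltn_add2l.
right; exists i2, m2; split=> //; first by lia.
  have := recorded_join n p r d p_gt0 _ _ _ _ _ _ _ _ _ _ _ _ bA R1.
  rewrite thetaS in R2; move=> /(_ _ _ _ _ _ R2); rewrite v0 le_max lexx orbT le_max lexx.
  rewrite (_ : l + 1 + u2 = u)%N; last by lia.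
  move=> /(_ isT isT) J0; rewrite (slotE n 1 _ (code n i0 m0)) // (env_V s) ?v0 //; last lia.
  by apply: J0 => //; lia.
by move=> c; rewrite candidateS // => -[/Hg|/joined_ge].
Qed.

Lemma search_spec A b base i m u s : joining A b base i m u s ->
  b \notin A -> (forall j, j \in A -> tnth d j <= tnth d b) ->
  (i <= n)%N -> (m + u <= n)%N ->
  wp n search
    (found (fun c => packed n p r d (b |: A) (theta n p r L i m) c u)
       A b base i m u) s.
Proof.
move=> J bA dA i_n mu; have [E Fl sold _ srel sdue _ su spos] := J.
rewrite /search; apply: wp_seq; apply: wp_asg => vq /= vqE.
have {}vqE : vq = (code n i m)%:Z.
  by rewrite vqE sold su spos (env_N3 s) //; lia.
have pos_old : var s 12 - var s 4 = (base + (code n i m + u))%N%:Z.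
  by rewrite spos (env_N3 s) //; lia.
have lt_u : (code n i m + u < width3 n)%N by apply: code_lt; lia.
have lt_0 : (code n i m + 0 < width3 n)%N by apply: code_lt; lia.
have Eu := Fl i m u i_n mu lt_u.
have [F0 S0] := entry0 _ _ _ _ _ _ _ _ _ _ _ (Fl i m 0%N i_n ltac:(lia) lt_0).
do 5 (apply: wp_seq; apply: wp_asg => ? /= ->).
rewrite (slotE n 2 _ _ pos_old) // pos_old sold vqE.
set s1 := setv _ 23 0.
have F1 : found (fun c => packed n p r d A (theta n p r L i m) c u)
    A b base i m u s1.
  exists (base + (code n i m + u))%N, (base + (code n i m + 0))%N.
  split; rewrite ?ltn_add2l //=; first by lia.
  apply: best_subset (subsetUr _ _) _; rewrite (_ : total s1 = total s) //.
  by apply: best_ext Eu => j; rewrite /total ?F0 ?S0 if_same !addr0.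
have J1 : joining A b base i m u s1.
  apply: joining_ext J => // x x18 _ /=.
  by do 6 (case: eqVneq => [?|_]; first by lia).
have Vq : arr s 1 (slot n 1 (code n i m)) = theta n p r L i m.
  by rewrite (slotE n 1 _ (code n i m)) ?(env_V s) //; lia.
apply: wp_if => /=; rewrite Vq srel (env_p s) // => rbp; last first.
  apply: wp_asg => v _; case: F1 => x1 [x2 [*]]; exists x1, x2; split=> //.
  by apply: best_unreleased => //; lia.
apply: (@wp_for _ _ _ _ (fun l =>
    found (candidate n p r d A b (theta n p r L i m) u l) A b base i m u)) => //.
- by apply: found_iff F1 => c; rewrite candidate0.
- move=> l s2 _ U s2l F2; have J2 := joining_unchanged _ _ _ _ _ _ _ _ _ U isT isT J1.
  have s2q : var s2 18 = (code n i m)%:Z by rewrite (proj1 U).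
  apply: wp_if => /=; rewrite s2l (joining_u _ _ _ _ _ _ _ J2) => lu.
    have H := attempt_spec _ _ _ _ _ _ _ _ J2 bA dA _ i_n mu _ s2q s2l F2.
    by apply: wp_weaken (H _ _) _ => //; lia.
  by apply: wp_asg => v _; apply: found_iff F2 => c; rewrite candidate_ge //; lia.
- move=> s2 _ [x1 [x2 [*]]]; exists x1, x2; split=> //.
  by apply: (best_candidate _ _ _ _ p_gt0 _ _ _ _ _ _ (n + true)%N) => //; lia.
Qed.

(** All writes to the stored schedules hit offset [P] in the block of some job, while the summands
    are read at smaller offsets and are thus never overwritten. *)
Lemma record_spec (b : 'I_n) (P : nat) s : env s ->
  var s 14 = (b : nat)%:Z -> var s 12 = P%:Z -> (P < width4 n)%N ->
  wp n record (fun s' => [/\ var s' 12 = P.+1%:Z, arr s' 2 P = var s 19,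
      forall x, x != P -> arr s' 2 x = arr s 2 x,
      forall x, (x < width4 n)%N -> x != P ->
        row s' 3 x =1 row s 3 x /\ row s' 4 x =1 row s 4 x
    & forall x1 x2 : nat, var s 20 = x1%:Z -> var s 21 = x2%:Z ->
        (x1 < P)%N -> (x2 < P)%N ->
        row s' 3 P =1 total s 3 x1 x2 b (var s 22) /\
        row s' 4 P =1 total s 4 x1 x2 b (var s 23)]) s.
Proof.
move=> E sb sP Plt; rewrite /record.
apply: wp_seq; apply: wp_put => _ _ /= -> ->.
rewrite (slotE n 2 _ _ sP) //; set s1 := seta s 2 P _.
have E1 : env s1.
  by apply: env_ext E => // k; rewrite !inE => /or4P[] /eqP->.
apply: wp_seq; apply: (@wp_for _ _ _ _ (fun l s' =>
   (forall x, (x < width4 n)%N -> x != P ->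
      row s' 3 x =1 row s 3 x /\ row s' 4 x =1 row s 4 x) /\
   (forall x1 x2 : nat, var s 20 = x1%:Z -> var s 21 = x2%:Z ->
        (x1 < P)%N -> (x2 < P)%N -> forall j : 'I_n, (j < l)%N ->
        row s' 3 P j = row s 3 x1 j + row s 3 x2 j /\
        row s' 4 P j = row s 4 x1 j + row s 4 x2 j))) => //.
  move=> l s2; rewrite addn0 => ln U s2l [I1 I2].
  have E2 : env s2 by exact: env_unchanged U isT isT E1.
  have J7 : arr s2 7 (slot n 7 (var s2 11)) = (l * width4 n)%N%:Z.
    by rewrite (slotE n 7 _ _ s2l) // (env_J s2).
  have [HV HA] := U.
  apply: wp_seq; apply: wp_put => _ v3 /= -> v3E; apply: wp_put => _ v4 /= -> v4E.
  have idx k v (x : nat) : k != 0%N -> v = x%:Z ->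
      slot n k (arr s2 7 (slot n 7 (var s2 11)) + v) = (l * width4 n + x)%N.
    by move=> k0 ->; apply: slotE => //; rewrite J7.
  have s2P : var s2 12 = P%:Z by rewrite HV.
  rewrite !(idx _ _ _ _ s2P) //; split=> [x xw xP|x1 x2 x1E x2E x1P x2P j].
    have [F3 F4] := I1 x xw xP.
    by split=> j; rewrite /row /= digits_eq // (negPf xP) andbF; [apply: F3 | apply: F4].
  rewrite ltnS leq_eqVlt => /orP[/eqP jl|jl]; last first.
    have [F3 F4] := I2 x1 x2 x1E x2E x1P x2P j jl.
    by rewrite /row /= digits_eq // eqxx andbT ltn_eqF //; split.
  have x1w : (x1 < width4 n)%N by lia.
  have x2w : (x2 < width4 n)%N by lia.
  have [F31 F41] := I1 x1 x1w (negbT (ltn_eqF x1P)).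
  have [F32 F42] := I1 x2 x2w (negbT (ltn_eqF x2P)).
  rewrite /row /= jl eqxx v3E v4E /=.
  rewrite -HV // in x1E; rewrite -HV // in x2E.
  rewrite !(idx _ _ _ _ x1E) // !(idx _ _ _ _ x2E) // -jl.
  by move: (F31 j) (F32 j) (F41 j) (F42 j); rewrite /row => -> -> -> ->.
move=> s2 U; rewrite addn0 => -[I1 I2].
have E2 : env s2 by exact: env_unchanged U isT isT E1.
have [HV HA] := U.
have s2b : var s2 14 = (b : nat)%:Z by rewrite HV.
have s2P : var s2 12 = P%:Z by rewrite HV.
have idx k : k != 0%N -> slot n k (arr s2 7 (slot n 7 (var s2 14)) + var s2 12) =
    (b * width4 n + P)%N.
  by move=> k0; apply: slotE => //; rewrite (slotE n 7 _ _ s2b) // (env_J s2) // s2P.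
do 2 (apply: wp_seq; apply: wp_put => _ _ /= -> ->); rewrite !idx //.
apply: wp_asg => v /= ->; split=> /=.
- by rewrite s2P; lia.
- by rewrite HA //= !eqxx.
- by move=> x xP; rewrite HA //= (negPf xP).
- move=> x xw xP; have [F3 F4] := I1 x xw xP.
  by split=> j; rewrite /row /= digits_eq // (negPf xP) andbF; [apply: F3 | apply: F4].
move=> x1 x2 x1E x2E x1P x2P.
split=> j; have [F3 F4] := I2 x1 x2 x1E x2E x1P x2P j (ltn_ord j);
  rewrite /row /= digits_eq // eqxx andbT /total -?F3 -?F4 !HV // val_eqE;
  by case: eqVneq => [->|_] //=; rewrite addr0.
Qed.

(** The program does not test [m + u <= n]. Beyond this bound the stored entry is arbitrary, but
    only the current cell is touched and the position still advances by one. *)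
Lemma step_spec A b base i m u s : joining A b base i m u s ->
  b \notin A -> (forall j, j \in A -> tnth d j <= tnth d b) ->
  (i <= n)%N -> (m <= n)%N -> (u <= n)%N ->
  (base + width3 n + width3 n <= width4 n)%N ->
  filled s (b |: A) (base + width3 n) (code n i m + u) ->
  wp n (search;; record)%prog (fun s' => [/\ filled s' A base (width3 n),
      filled s' (b |: A) (base + width3 n) (code n i m + u.+1)
    & var s' 12 = (base + width3 n + (code n i m + u.+1))%N%:Z]) s.
Proof.
move=> J bA dA i_n mn un room Fl.
have lt_c := code_lt n i m u i_n mn un.
apply: wp_seq; apply: (@wp_weaken _ _ (fun s1 => (m + u <= n)%N ->
    found (fun c => packed n p r d (b |: A) (theta n p r L i m) c u) A b base i m u s1)).
  have [mu|] := leqP (m + u) n.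
    by apply: wp_weaken (search_spec _ _ _ _ _ _ _ J bA dA i_n mu) _.
  by move=> H; rewrite /wp; lia.
move=> s1 U H1; have J1 := joining_unchanged _ _ _ _ _ _ _ _ _ U isT isT J.
have [HV HA] := U.
have {}Fl : filled s1 (b |: A) (base + width3 n) (code n i m + u).
  by apply: filled_ext Fl => k; rewrite !inE => /or3P[] /eqP-> x; apply: HA.
have [E FA _ sb _ _ _ _ sP] := J1.
have Plt : (base + width3 n + (code n i m + u) < width4 n)%N by lia.
apply: wp_weaken (record_spec b _ _ E sb sP Plt) _ => s2 _ [s2P T2 T2' R2 R2'].
have keep x : (x < width4 n)%N -> x != (base + width3 n + (code n i m + u))%N ->
    forall B i' m' u', entry n p r d L B i' m' u' (arr s1 2 x) (row s1 3 x) (row s1 4 x) ->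
    entry n p r d L B i' m' u' (arr s2 2 x) (row s2 3 x) (row s2 4 x).
  move=> xw xP B i' m' u'; rewrite T2' //; have [F3 F4] := R2 x xw xP.
  by apply: best_ext => j; rewrite ?F3 ?F4.
split; last by rewrite s2P; lia.
  move=> i' m' u' i'n mu' lt'; apply: keep; [lia..|exact: FA].
move=> i' m' u' i'n mu'; rewrite addnS ltnS leq_eqVlt => /orP[/eqP cE|lt'].
  have m'n : (m' <= n)%N by lia.
  have u'n : (u' <= n)%N by lia.
  have [-> m'E u'E] := code_inj n i' m' u' i m u m'n u'n mn un cE.
  rewrite m'E u'E T2; rewrite m'E u'E in mu'.
  have [x1 [x2 [x1E x2E x1w x2w B]]] := H1 mu'.
  have [||F3 F4] := R2' x1 x2 x1E x2E; try lia.
  by apply: best_ext B => j; rewrite ?F3 ?F4.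
by apply: keep; [lia..|exact: Fl].
Qed.

Lemma layer_spec A (b : 'I_n) base s : env s -> filled s A base (width3 n) ->
  b \notin A -> (forall j, j \in A -> tnth d j <= tnth d b) ->
  (base + width3 n + width3 n <= width4 n)%N ->
  var s 12 = (base + width3 n)%N%:Z -> var s 13 = base%:Z ->
  var s 14 = (b : nat)%:Z -> var s 15 = tnth r b -> var s 16 = tnth d b ->
  var s 17 = (code n b 0)%:Z ->
  wp n layer (fun s' => filled s' (b |: A) (base + width3 n) (width3 n) /\
    var s' 12 = (base + width3 n + width3 n)%N%:Z) s.
Proof.
move=> E Fl bA dA room s12 s13 s14 s15 s16 s17.
(* The three loops visit the cells in the order of their positions, so one bound [c] serves as
   invariant for all of them. *)
pose done_to c s' := [/\ filled s' A base (width3 n),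
  filled s' (b |: A) (base + width3 n) c & var s' 12 = (base + width3 n + c)%N%:Z].
rewrite /layer; apply: (@wp_for _ _ _ _ (fun i => done_to (code n i 0))) => //.
- by split=> //; rewrite /code !mul0n !addn0.
- move=> i s1 i_n U1 s1i D1.
  apply: (@wp_for _ _ _ _ (fun m => done_to (code n i m))) => //.
  + move=> m s2 m_n U2 s2m D2.
    apply: (@wp_for _ _ _ _ (fun u => done_to (code n i m + u)%N)) => //.
    * by rewrite addn0.
    * move=> u s3 u_n U3 s3u [FA FB s3P].
      have U := unchanged_trans _ _ _ _ (unchanged_trans _ _ _ _ U1
        (unchanged_for _ _ _ _ _ U2))
        (unchanged_for _ _ _ _ _ (unchanged_for _ _ _ _ _ U3)).
      have E3 := env_unchanged _ _ _ U isT isT E.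
      have J : joining A b base i m u s3.
        by case: U => HV _; split=> //; rewrite HV.
      apply: wp_weaken (step_spec _ _ _ _ _ _ _ J bA dA _ _ _ room FB) _; try lia.
      by [].
    * by move=> s3 _ D3; rewrite (_ : code n i m.+1 = code n i m + (n + true))%N // /code; lia.
  + by move=> s2 _ D2; rewrite (_ : code n i.+1 0 = code n i (n + true)) // /code; lia.
- move=> s1 _ [_ FB s1P].
  have wE : code n (n + true) 0 = width3 n by rewrite /code /width3; lia.
  by rewrite wE in FB s1P.
Qed.

Definition marked A s : Prop := forall j : 'I_n, arr s 5 j = (j \in A)%:Z.

Lemma select_spec A s : env s -> marked A s -> (#|A| < n)%N ->
  wp n select (fun s' => exists b : 'I_n, [/\ b \notin A,
    forall j, j \notin A -> tnth d b <= tnth d j, marked (b |: A) s'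
    & [/\ var s' 14 = (b : nat)%:Z, var s' 15 = tnth r b, var s' 16 = tnth d b
        & var s' 17 = (code n b 0)%:Z]]) s.
Proof.
move=> E M An; rewrite /select.
have n_gt0 : (0 < n)%N by lia.
have [j0 j0A] : exists j0, j0 \notin A.
  apply/existsP; apply: contraTT An => /existsPn H; rewrite -leqNgt.
  rewrite (_ : A = setT) ?cardsT ?card_ord //.
  by apply/setP=> j; rewrite inE; have := H j; rewrite negbK.
apply: wp_seq; apply: wp_asg => ? /= ->.
(* That [b] is unmarked is claimed only once the scan has met an unmarked job; before that [b] is
   the initial job 0. *)
apply: wp_seq; apply: (@wp_for _ _ _ _ (fun j s' => exists b : 'I_n,
    var s' 14 = (b : nat)%:Z /\
    forall j' : 'I_n, (j' < j)%N -> j' \notin A -> b \notin A /\ tnth d b <= tnth d j')) => //.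
- by exists (Ordinal n_gt0); split.
- move=> j s1; rewrite addn0 => jn U s1j [b [s1b H]]; have [HV HA] := U.
  have E1 : env s1.
    apply: env_unchanged U isT isT _.
    by apply: env_ext E => // -[|[|[|[|[|[|[|]]]]]]].
  pose j1 := Ordinal jn.
  have Mk v (k : 'I_n) : v = (k : nat)%:Z -> arr s1 5 (slot n 5 v) = (k \in A)%:Z.
    by move=> vk; rewrite (slotE n 5 _ _ vk) // HA // M.
  have Dk v (k : 'I_n) : v = (k : nat)%:Z -> arr s1 0 (slot n 0 (var s1 0 + v)) = tnth d k.
    move=> ->; rewrite (slot0E n _ (n + k)) ?(env_d s1) ?(env_n s1) //.
    by rewrite leq_add2l ltnW.
  have upd (k : 'I_n) : (b \notin A -> k \notin A /\ tnth d k <= tnth d b) ->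
      (j1 \notin A -> k \notin A /\ tnth d k <= tnth d j1) ->
      forall j' : 'I_n, (j' < j.+1)%N -> j' \notin A -> k \notin A /\ tnth d k <= tnth d j'.
    move=> kb kj j'; rewrite ltnS leq_eqVlt => /orP[/eqP jj|lt] j'A.
      by have jE : j' = j1 by [exact: val_inj]; rewrite jE in j'A *; apply: kj.
    by have [/kb[kA kd] bd] := H j' lt j'A; split=> //; apply: le_trans bd.
  apply: wp_if => /=; rewrite (Mk _ j1) // => jA.
    apply: wp_asg => v _; exists b; split=> //; apply: upd => //.
    by case: (_ \in _) jA.
  apply: wp_if => /=; rewrite (Mk _ b) // => bA.
    apply: wp_asg => v vE; exists j1; split; first by rewrite /= vE /= s1j.
    apply: upd => //.
    by case: (_ \in _) bA.
  have {}bA : b \notin A by case: (_ \in _) bA.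
  apply: wp_if => /=; rewrite (Dk _ b) // (Dk _ j1) // => bd; apply: wp_asg => v vE.
    exists j1; split; first by rewrite /= vE /= s1j.
    apply: upd => // _; split; last by lia.
    by case: (_ \in _) jA.
  by exists b; split=> //; apply: upd => // _; split=> //; lia.
move=> s1 U [b [s1b H]]; have [HV HA] := U.
have E1 : env s1.
  apply: env_unchanged U isT isT _.
  by apply: env_ext E => // -[|[|[|[|[|[|[|]]]]]]].
have [bA _] : b \notin A /\ tnth d b <= tnth d j0 by apply: H; rewrite ?addn0.
apply: wp_seq; apply: wp_put => _ _ /= -> ->.
do 2 (apply: wp_seq; apply: wp_asg => ? /= ->).
apply: wp_asg => ? /= ->; exists b; split=> // [j jA|j /=|].
- by have [|_] := H j _ jA; rewrite ?addn0.
- by rewrite (slotE n 5 _ _ s1b) // HA // M !inE val_eqE; case: eqVneq.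
split=> //=.
- by rewrite (slot0E n _ _ s1b) ?(env_r s1) //; have := ltn_ord b; lia.
- rewrite (slot0E n _ (n + b)) ?(env_d s1) //; last by have := ltn_ord b; lia.
  by rewrite (env_n s1) // s1b.
- by rewrite (slotE n 6 _ _ s1b) // (env_B s1) // ltnW.
Qed.

Lemma bottom_spec s : env s ->
  (forall k x, k \in [:: 3; 4]%N -> arr s k x = 0) ->
  wp n bottom (fun s' => filled s' set0 0 (width3 n) /\
    var s' 12 = (width3 n)%:Z) s.
Proof.
move=> E Z; rewrite /bottom; apply: wp_seq; apply: wp_asg => ? /= ->.
pose done_to c s' := var s' 12 = c%:Z /\
  forall i m u, (i <= n)%N -> (m <= n)%N -> (u <= n)%N -> (code n i m + u < c)%N ->
  arr s' 2 (code n i m + u)%N = if (0 < u)%N then 0 else (code n i m).+1%:Z.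
apply: (@wp_for _ _ _ _ (fun i => done_to (code n i 0))) => //.
- move=> i s1 i_n U1 s1i D1.
  apply: (@wp_for _ _ _ _ (fun m => done_to (code n i m))) => //.
  + move=> m s2 m_n U2 s2m D2.
    apply: (@wp_for _ _ _ _ (fun u => done_to (code n i m + u)%N)) => //.
    * by rewrite addn0.
    * move=> u s3 u_n U3 s3u [s3P T3].
      have upd v : v = (if (0 < u)%N then 0 else (code n i m).+1%:Z) ->
          done_to (code n i m + u.+1)%N
            (setv (setv (seta s3 2 (code n i m + u) v) 12 (code n i m + u.+1)%N%:Z) 9 u.+1%:Z).
        move=> vE; split=> //= i' m' u' i'n m'n u'n lt'.
        case: eqP => [eqc|nec]; last by apply: T3 => //; lia.
        have [-> -> ->] := code_inj n i' m' u' i m u m'n u'n ltac:(lia) ltac:(lia) eqc.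
        exact: vE.
      have posS : (var s3 12 + 1) = (code n i m + u.+1)%N%:Z by rewrite s3P; lia.
      apply: wp_seq; apply: wp_if => /=; rewrite s3u => u_pos;
        apply: wp_put => _ _ /= -> ->; apply: wp_asg => ? /= ->;
        rewrite (slotE n 2 _ _ s3P) // posS; apply: upd.
      - by rewrite (_ : (0 < u)%N); lia.
      - by rewrite (_ : (0 < u)%N = false); lia.
    * by move=> s3 _ D3; rewrite (_ : code n i m.+1 = code n i m + (n + true))%N // /code; lia.
  + by move=> s2 _ D2; rewrite (_ : code n i.+1 0 = code n i (n + true)) // /code; lia.
- move=> s1 [_ HA] [s1P T1].
  have wE : code n (n + true) 0 = width3 n by rewrite /code /width3; lia.
  rewrite wE in s1P T1; split=> // i m u i_n mu lt.
  rewrite !add0n T1 //; try lia.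
  have := entry_set0 n p r d p_gt0 L i m u i_n.
  by apply: best_ext => j; rewrite /row HA //= Z.
Qed.

Lemma values_spec s : var s 0 = n%:Z -> var s 1 = p -> var s 2 = n.+1%:Z ->
  var s 6 = L -> (forall j : 'I_n, arr s 0 j = tnth r j) ->
  wp n values (fun s' =>
    (forall i m, (i <= n)%N -> (m <= n)%N -> arr s' 1 (code n i m) = theta n p r L i m) /\
    forall i, (i <= n)%N -> arr s' 6 i = (code n i 0)%:Z) s.
Proof.
move=> s0 s1 s2 s6 sr; rewrite /values; apply: wp_seq; apply: wp_asg => ? /= ->.
pose upto c s' := var s' 18 = c%:Z /\
  forall i m, (m <= n)%N -> (code n i m < c)%N -> arr s' 1 (code n i m) = theta n p r L i m.
apply: (@wp_for _ _ _ _ (fun i s' => upto (code n i 0) s' /\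
  forall i', (i' < i)%N -> arr s' 6 i' = (code n i' 0)%:Z)) => //; last first.
  move=> a _ [[_ HV] HB]; split=> [i m i_n mn|i i_n]; last by apply: HB; rewrite addn1.
  by apply: HV => //; rewrite /code; nia.
move=> i a i_n U ai [[aq HV] HB].
apply: wp_seq; apply: wp_put => _ _ /= -> ->; rewrite (slotE n 6 _ _ ai) // aq.
set a1 := seta a 6 i _.
have [UV UA] := U.
apply: wp_seq; apply: (@wp_weaken _ _ (fun a2 => exists v,
    v = theta n p r L i 0 /\ a2 = setv a1 23 v)).
  rewrite /theta mulr0n addr0.
  apply: wp_if => /=; rewrite UV //= s0 ai => i_lt; apply: wp_asg => v /= ->.
    rewrite (slot0E n _ _ ai); last lia.
    have lt_in : (i < n)%N by lia.
    exists (arr a 0 i); split=> //.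
    by rewrite lt_in UA //= (sr (Ordinal lt_in)) (tnth_nth 0).
  rewrite (_ : (i < n)%N = false); last by lia.
  by exists L; split=> //; rewrite UV //= s6.
move=> _ _ [_ [-> ->]].
apply: (@wp_for _ _ _ _ (fun m a2 => [/\ upto (code n i m) a2,
    var a2 23 = theta n p r L i m
  & forall i', (i' < i.+1)%N -> arr a2 6 i' = (code n i' 0)%:Z])) => //.
- split=> // i' /=; rewrite ltnS leq_eqVlt => /orP[/eqP->|lt]; first by rewrite eqxx.
  by rewrite ltn_eqF // HB.
- move=> m a2 mn [UV2 _] a2m [[a2q HV2] a2v HB2].
  apply: wp_seq; apply: wp_put => _ _ /= -> ->; rewrite (slotE n 1 _ _ a2q) //.
  apply: wp_seq; apply: wp_asg => ? /= ->; apply: wp_asg => ? /= ->.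
  have a2p : var a2 1 = p by rewrite UV2 //= UV.
  have a2N : var a2 2 = n.+1%:Z by rewrite UV2 //= UV.
  rewrite a2p a2N a2q a2v.
  split=> //=; last by rewrite thetaS.
  split=> /=; first by rewrite /code; lia.
  move=> i' m' m'n lt; case: eqP => [cE|cN]; last first.
    apply: HV2 => //; rewrite !codeE in lt cN *.
    rewrite !ltn_pmul2r // in lt *.
    have : (i' * n.+1 + m' != i * n.+1 + m)%N by apply: contra_not_neq cN => ->.
    by lia.
  have [|-> -> _] := code_inj n i' m' 0 i m 0 m'n (leq0n _) ltac:(lia) (leq0n _); first by lia.
  by [].
- move=> a2 _ [D _ HB2]; split=> //.
  by rewrite (_ : code n i.+1 0 = code n i (n + true)) // /code; lia.
Qed.

Definition answered s : Prop := exists J S c,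
  [/\ sched n p r d setT L c J S,
    forall j : 'I_n, arr s 0 j = (j \in J)%:Z,
    forall j : 'I_n, j \in J -> arr s 0 (n + j) = S j
  & forall c' u, packed n p r d setT L c' u -> (u <= n)%N -> (u <= #|J|)%N].

Lemma answer_spec base s : env s -> filled s setT base (width3 n) ->
  (base + width3 n <= width4 n)%N -> var s 13 = base%:Z -> wp n answer answered s.
Proof.
move=> E Fl room s13; rewrite /answer.
have lt_c u : (u <= n)%N -> (code n n 0 + u < width3 n)%N by move=> ?; apply: code_lt.
pose T u := arr s 2 (base + (code n n 0 + u))%N.
have ET u : (u <= n)%N -> entry n p r d L setT n 0 u (T u)
    (row s 3 (base + (code n n 0 + u))) (row s 4 (base + (code n n 0 + u))).
  by move=> un; apply: Fl => //; exact: lt_c.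
have th0 : theta n p r L n 0 = L by rewrite /theta ltnn mulr0n addr0.
(* Nonzero entries mark exactly the feasible numbers of jobs; this is the direction that makes the
   largest such number optimal. *)
have Tpos u c : (u <= n)%N -> packed n p r d setT L c u -> 0 < T u.
  move=> un P; case: (ET u un) => [[_ /(_ c)]|[i [m [_ _ -> _ _]]] //].
  by rewrite th0.
apply: wp_seq; apply: wp_asg => vq /= vqE.
have {}vqE : vq = (base + code n n 0)%N%:Z.
  by rewrite vqE s13 (slotE n 6 _ n) ?(env_n s) // (env_B s).
apply: wp_seq; apply: wp_asg => ? /= ->.
apply: wp_seq; apply: (@wp_for _ _ _ _ (fun l s' => exists u0 : nat,
    [/\ var s' 21 = u0%:Z, (u0 <= n)%N, 0 < T u0
    & forall u, (u < l)%N -> 0 < T u -> (u <= u0)%N])) => //.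
- by exists 0%N; split=> //; apply: (Tpos _ L) => //; apply: packed0.
- move=> l s1 ln [HV HA] s1l [u0 [s1u u0n T0 H]].
  have TE : arr s1 2 (slot n 2 (var s1 18 + var s1 9)) = T l.
    by rewrite (slotE n 2 _ (base + (code n n 0 + l))) ?HA // HV //= vqE s1l; lia.
  apply: wp_if => /=; rewrite TE => Tl; apply: wp_asg => v /= vE.
    by exists l; split; [rewrite /= vE s1l | lia | | move=> u; rewrite ltnS].
  exists u0; split=> // u; rewrite ltnS leq_eqVlt => /orP[/eqP->|/H //].
  by move: Tl; lia.
move=> s1 [HV HA] [u0 [s1u u0n T0 Hmax]].
pose x := (base + (code n n 0 + u0))%N.
have xw : (x < width4 n)%N by have := lt_c u0 u0n; rewrite /x; lia.
apply: wp_seq; apply: wp_asg => v1 /= v1E.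
have {}v1E : v1 = x%:Z by rewrite v1E HV //= vqE s1u /x; lia.
apply: (@wp_for _ _ _ _ (fun l s' => forall j : 'I_n, (j < l)%N ->
    arr s' 0 j = row s 3 x j /\ arr s' 0 (n + j) = row s 4 x j)) => //.
- move=> l s2; rewrite addn0 => ln [HV2 HA2] s2l I2.
  apply wp_seq; apply: wp_put => _ _ /= -> ->; apply wp_put => _ _ /= -> ->.
  have s2n : var s2 0 = n%:Z by rewrite HV2 //= HV //= (env_n s).
  have idx k : k != 0%N ->
      slot n k (arr s2 7 (slot n 7 (var s2 11)) + var s2 20) = (l * width4 n + x)%N.
    move=> k0; apply: slotE => //; rewrite (slotE n 7 _ _ s2l) // HA2 //= HA //=.
    by rewrite (env_J s) // HV2 //= v1E; lia.
  rewrite !idx // (slot0E n _ _ s2l); last by lia.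
  rewrite (slot0E n _ (n + l)); [|by rewrite s2n s2l; lia|by lia].
  move=> j; have jn := ltn_ord j.
  have N1 : (nat_of_ord j == n + l)%N = false by lia.
  have N2 : (n + j == l)%N = false by lia.
  have N3 : (n + j == n + l)%N = (nat_of_ord j == l) by rewrite eqn_add2l.
  rewrite ltnS leq_eqVlt => /orP[/eqP jl|jl] /=.
    rewrite N1 N2 N3 (introT eqP jl) /row jl.
    by rewrite (HA2 3%N) // (HA2 4%N) //= (HA 3%N) // (HA 4%N).
  by rewrite N1 N2 N3 (ltn_eqF jl); exact: I2.
move=> s2 _ H2; have := ET u0 u0n; rewrite -/x.
case=> [[T00 _]|[i' [m' [_ _ _ [J [Sc JE HF HS]] _]]]]; first by rewrite T00 in T0.
exists J, (row s 4 x), (theta n p r L i' m'); rewrite th0 in Sc; split=> //.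
- by move=> j; have [-> _] := H2 j ltac:(by rewrite addn0).
- by move=> j _; have [_ ->] := H2 j ltac:(by rewrite addn0).
- move=> c' u P un; rewrite JE; apply: Hmax; first by rewrite addn1.
  exact: Tpos P.
Qed.

Lemma layers_spec s : env s -> filled s set0 0 (width3 n) -> marked set0 s ->
  var s 12 = (width3 n)%:Z ->
  wp n (13 <- Cst 0;; For 28 false (select;; layer;; 13 <- 13 + 4);; answer)%N%prog
    answered s.
Proof.
move=> E Fl M s12; apply: wp_seq; apply: wp_asg => ? /= ->.
(* [A] is the set of the [k] jobs selected so far. After n rounds its cardinality makes it the full
   set. *)
apply: wp_seq; apply: (@wp_for _ _ _ _ (fun k s' => exists A : {set 'I_n},
  [/\ #|A| = k, marked A s', filled s' A (k * width3 n) (width3 n),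
     var s' 13 = (k * width3 n)%N%:Z /\ var s' 12 = (k * width3 n + width3 n)%N%:Z
   & forall i j, i \in A -> j \notin A -> tnth d i <= tnth d j])) => //.
- exists set0; rewrite cards0; split=> // i j; by rewrite inE.
- move=> k s1; rewrite addn0 => kn U s1k [A [Ak M1 F1 [s113 s112] dA]].
  have E0 : env (setv s 13 0) by apply: env_ext E => // -[|[|[|[|[|[|[|]]]]]]].
  have E1 := env_unchanged _ _ _ U isT isT E0.
  apply: wp_seq; apply: wp_weaken (select_spec _ _ E1 M1 _) _; first by rewrite Ak.
  move=> s2 U2 [b [bA dmin M2 [s2b s2r s2d s2q]]]; have [HV2 HA2] := U2.
  have E2 := env_unchanged _ _ _ U2 isT isT E1.
  have F2 : filled s2 A (k * width3 n) (width3 n).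
    by apply: filled_ext F1 => x; rewrite !inE => /or3P[] /eqP-> y; apply: HA2.
  have room : (k * width3 n + width3 n + width3 n <= width4 n)%N.
    by rewrite /width4 -/(width3 n); nia.
  apply: wp_seq.
  apply: wp_weaken (layer_spec A b _ _ E2 F2 bA _ room _ _ s2b s2r s2d s2q) _.
  + by move=> j jA; apply: dA.
  + by rewrite HV2.
  + by rewrite HV2.
  move=> s3 U3 [F3 s312]; have [HV3 HA3] := U3.
  have E3 := env_unchanged _ _ _ U3 isT isT E2.
  apply: wp_asg => v /= ->; exists (b |: A); split=> /=.
  + by rewrite cardsU1 bA Ak.
  + by move=> j /=; rewrite HA3.
  + by rewrite mulSn addnC.
  + by rewrite (env_N3 s3) // s312 HV3 // HV2 // s113; split; lia.
  + move=> i j; rewrite !inE negb_or => /orP[/eqP->|iA] /andP[_ jA]; first exact: dmin.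
    exact: dA.
move=> s1 U; rewrite addn0 => -[A [An _ F1 [s113 _] _]].
have E0 : env (setv s 13 0) by apply: env_ext E => // -[|[|[|[|[|[|[|]]]]]]].
have E1 := env_unchanged _ _ _ U isT isT E0.
apply: (answer_spec _ _ E1 _ _ s113); last by rewrite /width4 -/(width3 n); nia.
rewrite (_ : setT = A) //; apply/esym/eqP.
by rewrite eqEcard subsetT cardsT card_ord An /=.
Qed.
End Scheduler.

(** * Real start times *)

Definition initial (n : nat) (p : int) (r d : n.-tuple int) : store :=
  Store (nth 0 [:: n%:Z; p]) (fun k i => if k == 0%N then nth 0 (r ++ d) i else 0).

Lemma sim_input n p (r d : n.-tuple int) : sim n (input p r d) (initial n p r d).
Proof.
split=> // k i k8 _; rewrite /= /addr; case: eqP => // _.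
by rewrite nth_default // size_cat !size_tuple; lia.
Qed.

Lemma scheduler_spec n p (r d : n.-tuple int) : 0 < p ->
  wp n scheduler (fun s => exists2 L, forall j, L <= tnth r j & answered n p r d L s)
    (initial n p r d).
Proof.
move=> p_gt0; set s0 := initial _ _ _ _.
have r0 (j : 'I_n) : arr s0 0 j = tnth r j.
  by rewrite /= nth_cat size_tuple ltn_ord (tnth_nth 0).
have d0 (j : 'I_n) : arr s0 0 (n + j) = tnth d j.
  by rewrite /= nth_cat size_tuple ltnNge leq_addr addKn (tnth_nth 0).
rewrite /scheduler.
apply: wp_seq; apply: wp_weaken (powers_spec n s0 _ _ _ _) _ => //.
move=> s1 [HV1 HA1] [s12 s13 s14 s15].
apply: wp_seq; apply: wp_weaken (lower_bound_spec n r s1 _) _.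
  by move=> j; rewrite HA1.
move=> s2 [HV2 HA2] low.
apply: wp_seq; apply: wp_weaken (strides_spec n s2 _) _; first by rewrite HV2.
move=> s3 [HV3 HA3] J3.
pose L := var s2 6.
apply: wp_seq; apply: wp_weaken (values_spec n p r L p_gt0 s3 _ _ _ _ _) _.
- by rewrite HV3 // HV2 // HV1.
- by rewrite HV3 // HV2 // HV1.
- by rewrite HV3 // HV2.
- by rewrite HV3.
- by move=> j; rewrite HA3 // HA2 // HA1.
move=> s4 [HV4 HA4] [V4 B4].
have E4 : env n p r d L s4.
  split; rewrite ?HV4 // ?HV3 // ?HV2 // ?HV1 //.
  - by move=> j; rewrite HA4 // HA3 // HA2 // HA1.
  - by move=> j; rewrite HA4 // HA3 // HA2 // HA1.
  - by move=> j jn; rewrite HA4 // J3.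
apply: wp_seq; apply: wp_weaken (bottom_spec n p r d L p_gt0 s4 E4 _) _.
  by move=> k x; rewrite !inE => /orP[] /eqP->; rewrite HA4 // HA3 // HA2 // HA1.
move=> s5 U5 [F5 s512]; have [HV5 HA5] := U5.
apply: wp_weaken (layers_spec n p r d L p_gt0 s5 _ F5 _ s512) _.
- exact: env_unchanged U5 isT isT E4.
- by move=> j; rewrite HA5 // HA4 // HA3 // HA2 // HA1 //= inE.
by move=> s6 _; exists L.
Qed.

Section Real.
Variables (R : realType) (n : nat) (p : int) (r d : n.-tuple int).
Hypothesis p_gt0 : 0 < p.

Lemma disjoint_itv (a b : R) :
  (forall x : R, ~ ((x \in `]a, a + p%:~R[) /\ (x \in `]b, b + p%:~R[))) ->
  a + p%:~R <= b \/ b + p%:~R <= a.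
Proof.
have pR : 0 < p%:~R :> R by rewrite ltr0z.
wlog ab : a b / a <= b => [th|] dis.
  have [/th//|/ltW ba] := leP a b; first exact.
  by have [|||] := th b a => // [x [] *|?|?]; [apply: (dis x) | right | left].
have [|lt] := leP (a + p%:~R) b; first by left.
(* If the intervals overlap, the midpoint of [b] and [a + p] lies inside both. *)
have [lt1 lt2] := midf_lt lt.
case: (dis ((b + (a + p%:~R)) / 2%:R)); rewrite !in_itv /=; split; apply/andP; split=> //.
  exact: le_lt_trans lt1.
by apply: lt_le_trans lt2 _; rewrite lerD2r.
Qed.

(** Flooring commutes with adding the integer p, which preserves the gaps; integral release times
    survive flooring, and deadlines are met since starts only decrease. *)
Lemma feasible_sched L (S : schedule R n) : (forall j, L <= tnth r j) ->
  feasible p r d S -> exists c, packed n p r d setT L c (throughput S).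
Proof.
move=> low [bounds dis].
pose S' j := if S j is Some a then Num.floor a else 0.
(* A crude common bound of [L] and all deadlines. *)
exists (`|L| + \sum_j `|tnth d j|), [set j | S j], S'; split=> //; split=> //.
- have : 0 <= \sum_j `|tnth d j| by apply: sumr_ge0.
  by lia.
- move=> j; rewrite inE /S'; case Sj : (S j) => [a|] // _.
  have [ra ad] := bounds j a Sj.
  have rf : tnth r j <= Num.floor a by rewrite floor_ge_int.
  have fd : Num.floor a + p <= tnth d j.
    rewrite -(ler_int R) intrD; apply: le_trans ad; rewrite lerD2r.
    exact: floor_le.
  have lj := low j; split=> //; try lia.
  apply: le_trans fd _; rewrite -[tnth d j]add0r lerD // (bigD1 j) //=.
  by rewrite (le_trans (ler_norm _)) // lerDl sumr_ge0.
move=> i j; rewrite !inE /S'.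
case Si : (S i) => [a|] // _; case Sj : (S j) => [b|] // _ ij.
have fl x y : x + p%:~R <= y :> R -> Num.floor x + p <= Num.floor y.
  move=> xy; rewrite floor_ge_int intrD; apply: le_trans xy; rewrite lerD2r.
  exact: floor_le.
by have [/fl|/fl] := disjoint_itv _ _ (dis i j a b ij Si Sj); [left|right].
Qed.

Lemma sched_feasible L c J (S : 'I_n -> int) : sched n p r d setT L c J S ->
  feasible p r d (fun j => if j \in J then Some (S j)%:~R else None : option R).
Proof.
case=> _ _ HJ dis; split=> [j a|i j a b ij].
  case: ifP => // jJ [<-]; have [_ rS _ _ Sd] := HJ j jJ.
  by rewrite -intrD !ler_int.
case: ifP => // iJ [<-]; case: ifP => // jJ [<-] x.
rewrite !in_itv /= -!intrD => -[/andP[ix xi] /andP[jx xj]].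
have := lt_trans ix xj; have := lt_trans jx xi; rewrite !ltr_int.
by have [] := dis i j iJ jJ ij; lia.
Qed.
End Real.

Theorem theorem1 :
  exists (prog : cmd) (C : nat),
    forall (n : nat) (p : int) (r d : n.-tuple int), 0 < p ->
    exists (t : nat) (s : state),
      [/\ exec prog (input p r d) t s,
          (0 < n)%N -> (t <= C * n ^ 5)%N
        & forall R : realType, optimal p r d (@output R n s)].
Proof.
(* For n >= 1 one has (n + 1)^5 <= (2 n)^5, whence the factor 2^5. *)
exists (compile scheduler 32), (cost scheduler * 2 ^ 5)%N => n p r d p_gt0.
have [t [s [X tle sim_s _]]] :=
  exec_compile n scheduler _ _ 32 (sim_input n p r d) isT isT.
exists t, s; split=> // [n_gt0|R].
  apply: leq_trans tle _; rewrite -mulnA -expnMn leq_mul2l leq_exp2r //.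
  by lia.
move: sim_s (scheduler_spec n p r d p_gt0); rewrite /wp.
move: (den _ _ _) => a [_ _ S] [L low [J [T [c [Sc H0 H1 Hmax]]]]].
have out : @output R n s =1 fun j => if j \in J then Some (T j)%:~R else None.
  move=> j; have jn := ltn_ord j.
  have := S 0%N j isT; have := S 0%N (n + j)%N isT; rewrite /addr /= /output.
  move=> -> => [->|_]; [|lia|lia].
  by rewrite H0; case: (boolP (j \in J)) => [jJ|_] //=; rewrite H1.
have [bounds dis] := sched_feasible R n p r d p_gt0 L c J T Sc.
split; first by split=> [j x|i j x y ij]; rewrite !out; [exact: bounds | exact: dis].
move=> S' /(feasible_sched R n p r d p_gt0 L S' low) [c' P'].
rewrite {2}/throughput (_ : [set j | _] = J).
  by apply: Hmax P' _; rewrite -[n in (_ <= n)%N]card_ord max_card.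
by apply/setP=> j; rewrite inE out; case: ifP.
Qed.
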